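(* Let $f,g:\mathbb{X}\to\overline{\mathbb{R}}$ and $h:\mathbb{X}\to\mathbb{R}$ satisfy: (i) $f$ is proper and lower semicontinuous, and is continuously differentiable on an open set $\mathcal{O}\supset{\rm dom}\,g\neq\emptyset$ with $\nabla f$ strictly continuous (i.e. locally Lipschitz) on $\mathcal{O}$; (ii) $g$ is proper, lower semicontinuous and bounded from below; (iii) $h$ is convex, and $F:=f+g-h$ is bounded from below. Let $\{x^k\}_{k\in\mathbb{N}}$ be the (infinite) sequence generated by the nonmonotone proximal gradient method with majorization described in the context. Suppose that the function $$\Theta(x,s):=f(x)+g(x)+\langle s,x\rangle+h^*(-s),\qquad (x,s)\in\mathbb{X}\times\mathbb{X},$$ is a KL function, where $h^*$ is the convex conjugate of $h$, and that the set $\mathcal{L}_F(x^0):=\{x\in\mathbb{X}: F(x)\le F(x^0)\}$ is bounded. Then $\{x^k\}_{k\in\mathbb{N}}$ converges to a point $\overline{x}$ satisfying $0\in\nabla f(\overline{x})+\partial g(\overline{x})+\partial(-h)(\overline{x})$. If moreover $\Theta$ is a KL function of exponent $\theta\in(0,1)$, then there exist $C>0$ and $q\in(0,1)$ such that for all $k$ large enough, $$\|x^k-\overline{x}\|\le\sum_{j=k}^\infty\|x^{j+1}-x^j\|\le\begin{cases}C q^k&\text{if }\theta\in(0,1/2],\\ C k^{\frac{1-\theta}{1-2\theta}}&\text{if }\theta\in(1/2,1).\end{cases}$$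
   Context: $\mathbb{X}$ is a finite-dimensional real inner product space with induced norm $\|\cdot\|$, $\overline{\mathbb{R}}=(-\infty,\infty]$, $\mathbb{N}=\{0,1,2,\dots\}$, $\partial$ is the limiting (Mordukhovich) subdifferential, ${\rm dist}(0,\emptyset)=\infty$. Algorithm. Input: $m\in\mathbb{N}$, $0<\gamma_{\min}\le\gamma_{\max}<\infty$, $\varrho>1$, $\delta\in(0,1)$, $\alpha\in[0,1]$, $c>0$, $x^0\in{\rm dom}\,g$. At iteration $k=0,1,2,\dots$: choose $\gamma_{k,0}\in[\gamma_{\min},\gamma_{\max}]$. Inner loop: for $j=0,1,2,\dots$, let $\gamma_{k,j}:=\varrho^j\gamma_{k,0}$, pick any $\xi^k\in\partial(-h)(x^k)$, and compute an optimal solution $x^{k,j}$ of $$\min_{x\in\mathbb{X}}\ f(x^k)+\langle\nabla f(x^k)+\xi^k,x-x^k\rangle+\frac{\gamma_{k,j}}{2}\|x-x^k\|^2+g(x);$$ stop the inner loop at the first $j$ for which $$F(x^{k,j})\le\max_{\max\{0,k-m\}\le i\le k}F(x^i)-\frac{\alpha\delta\gamma_{k,j}+(1-\alpha)c}{2}\|x^{k,j}-x^k\|^2.$$ With this $j=:j_k$, set $\gamma_k:=\gamma_{k,j_k}$ and $x^{k+1}:=x^{k,j_k}$ ($\xi^k$ then denotes the subgradient used to compute $x^{k+1}$). KL property: for $\eta\in(0,\infty]$ let $\Upsilon_\eta$ be the family of continuous concave $\varphi:[0,\eta)\to\mathbb{R}_+$ that are continuously differentiable on $(0,\eta)$ with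 $\varphi'>0$ on $(0,\eta)$ and $\varphi(0)=0$. A proper function $p$ has the KL property at $\overline{u}\in{\rm dom}\,\partial p$ if there exist $\eta\in(0,\infty]$, a neighborhood $\mathcal{U}$ of $\overline{u}$ and $\varphi\in\Upsilon_\eta$ such that $\varphi'(p(u)-p(\overline{u}))\,{\rm dist}(0,\partial p(u))\ge1$ for all $u\in\mathcal{U}$ with $p(\overline{u})<p(u)<p(\overline{u})+\eta$; it has the KL property of exponent $\theta\in[0,1)$ at $\overline{u}$ if $\varphi$ can be chosen as $\varphi(t)=c_0t^{1-\theta}$ for some $c_0>0$. $p$ is a KL function (of exponent $\theta$) if it has the KL property (of exponent $\theta$) at every point of ${\rm dom}\,\partial p$. *)

(* Defs.v *)
From HB Require Import structures.
From mathcomp Require Import all_boot all_order all_algebra.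
From mathcomp Require Import sesquilinear.
From mathcomp Require Import all_classical all_reals all_analysis.

Set Implicit Arguments.
Unset Strict Implicit.
Unset Printing Implicit Defensive.

Import Order.TTheory GRing.Theory Num.Theory.
Import numFieldNormedType.Exports.

Local Open Scope classical_set_scope.
Local Open Scope ring_scope.

(* To be used with ip : {dot X for idfun}: X is then a finite-dimensional real
   inner product space whose library norm is the one induced by ip. *)
Definition is_euclidean (R : realType) (X : normedModType R)
    (ip : X -> X -> R) : Prop :=
  (forall x : X, `|x| = Num.sqrt (ip x x)) /\
  exists (n : nat) (e : 'I_n -> X),
    forall x : X, exists a : 'I_n -> R, x = \sum_(i < n) a i *: e i.

(* The library norm of X * X is the max norm, so norms on E = X * X are taken
   from the inner product; only the topology comes from the library. *)
Definition ipnorm (R : realType) (E : lmodType R) (ip : E -> E -> R) (u : E)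
  : R := Num.sqrt (ip u u).

Definition prod_ip (R : realType) (X : lmodType R) (ip : X -> X -> R)
    (u v : X * X) : R := ip u.1 v.1 + ip u.2 v.2.

Section ExtendedRealFunctions.
Context {R : realType}.
Local Open Scope ereal_scope.

Definition edom (T : Type) (p : T -> \bar R) : set T := [set x | p x < +oo].

Definition proper_efun (T : Type) (p : T -> \bar R) : Prop :=
  edom p !=set0 /\ forall x, p x != -oo.

Definition bounded_below (T : Type) (p : T -> \bar R) : Prop :=
  exists b : R, forall x, b%:E <= p x.

Definition minimizer (T : Type) (p : T -> \bar R) (x : T) : Prop :=
  forall y, p x <= p y.

Context {E : normedModType R} (ip : E -> E -> R).

(* p y >= p x + <v, y - x> + o(|y - x|) as y --> x. *)
Definition regular_subdiff (p : E -> \bar R) (x : E) : set E :=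
  [set v | p x \is a fin_num /\
    forall eps : R, (0 < eps)%R -> \forall y \near x,
      p x + (ip v (y - x) - eps * ipnorm ip (y - x))%:E <= p y].

Definition limiting_subdiff (p : E -> \bar R) (x : E) : set E :=
  [set v | p x \is a fin_num /\
    exists (xs vs : nat -> E),
      [/\ xs @ \oo --> x, (p \o xs) @ \oo --> p x, vs @ \oo --> v &
          forall k, regular_subdiff p (xs k) (vs k)]].

Definition dom_subdiff (p : E -> \bar R) : set E :=
  [set x | limiting_subdiff p x !=set0].

(* ereal_inf set0 = +oo gives the convention dist(0, set0) = +oo. *)
Definition dist0 (A : set E) : \bar R :=
  ereal_inf [set (ipnorm ip v)%:E | v in A].

Definition convex_conjugate (h : E -> R) (s : E) : \bar R :=
  ereal_sup [set (ip s x - h x)%:E | x in [set: E]].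

(* phi is a total function, of which only the values on [0, eta) matter.
   Concavity of phi is convexity of - phi. *)
Definition desingularizing (eta : \bar R) (phi : R -> R) : Prop :=
  let D := [set t : R | (0 <= t)%R /\ t%:E < eta] in
  [/\ (forall t, D t -> (0 <= phi t)%R),
      phi 0%R = 0%R,
      {within D, continuous phi},
      convex_function (E := R^o) D (fun t => - phi t)%R &
      forall t : R, (0 < t)%R -> t%:E < eta ->
        [/\ derivable phi t 1%R, {for t, continuous (derive1 phi)} &
            (0 < derive1 phi t)%R]].

Definition KL_inequality (p : E -> \bar R) (ubar : E) (eta : \bar R)
    (U : set E) (phi : R -> R) : Prop :=
  forall u, U u -> p ubar < p u -> p u < p ubar + eta ->
    1 <= (derive1 phi (fine (p u - p ubar)))%:E * dist0 (limiting_subdiff p u).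

Definition KL_at (p : E -> \bar R) (ubar : E) : Prop :=
  exists (eta : \bar R) (U : set E) (phi : R -> R),
    [/\ 0 < eta, nbhs ubar U, desingularizing eta phi &
        KL_inequality p ubar eta U phi].

Definition KL_exponent_at (theta : R) (p : E -> \bar R) (ubar : E) : Prop :=
  exists (eta : \bar R) (U : set E) (c0 : R),
    let phi := fun t : R => (c0 * t `^ (1 - theta))%R in
    [/\ 0 < eta, nbhs ubar U, (0 < c0)%R, desingularizing eta phi &
        KL_inequality p ubar eta U phi].

Definition KL_function (p : E -> \bar R) : Prop :=
  forall u, dom_subdiff p u -> KL_at p u.

Definition KL_function_exponent (theta : R) (p : E -> \bar R) : Prop :=
  forall u, dom_subdiff p u -> KL_exponent_at theta p u.

End ExtendedRealFunctions.

Section Problem.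
Context {R : realType} {X : normedModType R} (ip : X -> X -> R).
Local Open Scope ereal_scope.

Definition C1_gradient (O : set X) (f : X -> \bar R) (grad : X -> X) : Prop :=
  (forall x, O x ->
    [/\ f x \is a fin_num, differentiable (fine \o f : X -> R^o) x &
        forall v, 'd (fine \o f : X -> R^o) x v = ip (grad x) v]) /\
  forall x, O x -> {for x, continuous grad}.

Definition locally_lipschitz (O : set X) (G : X -> X) : Prop :=
  forall x, O x -> exists2 U, nbhs x U & [lipschitz G y | y in U].

Definition objective (f g : X -> \bar R) (h : X -> R) (x : X) : \bar R :=
  f x + g x - (h x)%:E.

Definition neg_fun (h : X -> R) (x : X) : \bar R := (- h x)%:E.

Definition merit (f g : X -> \bar R) (h : X -> R) (z : X * X) : \bar R :=
  f z.1 + g z.1 + (ip z.2 z.1)%:E + convex_conjugate ip h (- z.2)%R.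

Definition stationary (g : X -> \bar R) (h : X -> R) (grad : X -> X) (x : X)
  : Prop :=
  exists v w, [/\ limiting_subdiff ip g x v, limiting_subdiff ip (neg_fun h) x w &
                  (0 = grad x + v + w)%R].

Definition subproblem (f g : X -> \bar R) (grad : X -> X) (xk xi : X)
    (gam : R) (y : X) : \bar R :=
  f xk + (ip (grad xk + xi) (y - xk) + gam / 2 * `|y - xk| ^+ 2)%R%:E + g y.

(* Acceptance test at iteration k for the trial point y; the truncated
   subtraction k - m is max{0, k - m}. *)
Definition accepted (F : X -> \bar R) (m : nat) (delta alpha c : R)
    (x : nat -> X) (k : nat) (gam : R) (y : X) : Prop :=
  F y <= (\big[maxe/-oo]_((k - m)%N <= i < k.+1) F (x i))
         - ((alpha * delta * gam + (1 - alpha) * c) / 2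
            * `|y - x k| ^+ 2)%R%:E.

(* x is an infinite sequence of iterates: at iteration k the trial points
   y 0, ..., y j are computed, from the possibly different subgradients
   xi 0, ..., xi j, and y j is the first accepted one. *)
Definition NPG_sequence (f g : X -> \bar R) (h : X -> R) (grad : X -> X)
    (m : nat) (gmin gmax rho delta alpha c : R) (x : nat -> X) : Prop :=
  let test := accepted (objective f g h) m delta alpha c x in
  edom g (x 0%N) /\
  forall k : nat, exists (gam0 : R) (j : nat) (xi y : nat -> X),
    let gam i := (rho ^+ i * gam0)%R in
    [/\ (gmin <= gam0 <= gmax)%R,
        (forall i, (i <= j)%N ->
           limiting_subdiff ip (neg_fun h) (x k) (xi i) /\
           minimizer (subproblem f g grad (x k) (xi i) (gam i)) (y i)),
        (forall i, (i < j)%N -> ~ test k (gam i) (y i)),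
        test k (gam j) (y j) &
        x k.+1 = y j].

End Problem.

(* Main.v *)
Require Import Defs.
From HB Require Import structures.
From mathcomp Require Import all_boot all_order all_algebra.
From mathcomp Require Import sesquilinear.
From mathcomp Require Import all_classical all_reals all_analysis.
From mathcomp Require Import ring lra.

Set Implicit Arguments.
Unset Strict Implicit.
Unset Printing Implicit Defensive.

Import Order.TTheory GRing.Theory Num.Theory.
Import numFieldNormedType.Exports.

Local Open Scope classical_set_scope.
Local Open Scope ring_scope.


(** Why the theorem holds.  Write Theta for the merit function, F for the
    objective, D k for the length of the step from x k to x k.+1 and z k for the
    pair (x k.+1, xi k).  A regular subgradient of - h at a point is the opposite
    of a convex subgradient of h, so the conjugate in Theta (z k) is given by
    Fenchel's equality, and F (x k.+1) <= Theta (z k).  Comparing x k.+1 with x k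
    in the subproblem and using the descent inequality of f gives
    Theta (z k) <= F (x k) + L * D k ^ 2 for short steps, and the optimality of
    x k.+1 makes an explicit vector of length O(D k) a regular subgradient of
    Theta at z k ([merit_regular]).  The sublevel set of F at x 0 is compact and
    lies in the open set where f is smooth; on it all constants are uniform, and
    the stepsize parameters stay bounded because large ones are accepted
    ([NPG_iterates]).

    The values F (x k) need not decrease, but their maxima M k over windows of
    m + 1 indices do.  Since F (x k.+1) <= F (x k) + L * D k ^ 2, the value just
    before a window maximum cannot be much smaller than that maximum.  Walking
    backwards from the maximum, one finds D k ^ 2 <= C * (M k - M (k + m + 1))
    ([step_le_window_drop]).  So the steps vanish and F (x k) has the limit Fs of
    M k.  Every cluster point of z then has Theta-value
    Fs and carries the subgradient 0, and its first component is stationary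
    ([cluster_point]).

    The Kurdyka-Lojasiewicz inequalities at the cluster points are merged into
    one along the sequence ([uniform_KL]).  It is used only at those z q for which
    F (x q.+1) is a window maximum M k: as Theta (z q) >= M k and the derivative
    of a concave function decreases, it may be read at the argument
    r k = M k - Fs ([KL_along]).  Nonmonotonicity is thus harmless: everything is
    expressed by the nonincreasing sequence r, in the form
    1 <= psi (r (k + N)) * b * sqrt (r k - r (k + N)) with N = m + 1.  Concavity
    and a telescoping potential bound the sum of the sqrt (r k - r (k + N)), hence
    of the D k, from j on by a multiple of sqrt (r j) + phi (r j)
    ([KL_tail_le]).  This gives convergence, and for phi t = c * t ^ (1 - theta)
    the recursion r (k + N) ^ (2 * theta) <= C * (r k - r (k + N)) yields the
    rates ([KL_tail_rate]). *)

(** * Compactness and Euclidean geometry *)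

(** A property of sets that is local, monotone and stable under finite unions
    passes from points to compact sets: otherwise the complements of the good
    sets would generate a proper filter on the compact set, without any
    cluster point.  All finite-subcover arguments below have this form. *)
Lemma compact_induction (T : topologicalType) (K : set T) (P : set T -> Prop) :
  compact K -> P set0 -> (forall A B, A `<=` B -> P B -> P A) ->
  (forall A B, P A -> P B -> P (A `|` B)) ->
  (forall x, K x -> exists2 U, nbhs x U & P U) -> P K.
Proof.
move=> cK P0 Pmono PU Ploc; apply: contrapT => nPK.
pose F : set_system T := [set A | P (K `\` A)].
have FF : ProperFilter F.
  apply: Build_ProperFilter_ex.
    move=> B FB; apply: contrapT => nB; apply: nPK.
    apply: Pmono FB => y Ky; split=> // By; apply: nB; by exists y.
  split.
  - by rewrite /F /= setDT.
  - by move=> A B FA FB; rewrite /F /= setDIr; exact: PU.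
  - by move=> A B AB; apply: Pmono; exact: setDS.
have [|p [Kp clp]] := cK F FF; first by rewrite /F /= setDv.
have [U pU PUU] := Ploc p Kp.
have FU : F (~` U) by apply: Pmono PUU => y -[_ /contrapT].
by have [y [/= ]] := clp _ _ FU pU.
Qed.

Section InnerProduct.
Context {R : realType} {X : normedModType R} (ip : {dot X for (@idfun R)}).
Hypothesis normE : forall x : X, `|x| = Num.sqrt (ip x x).

Lemma ipC u v : ip u v = ip v u.
Proof. by rewrite hermC expr0 mul1r. Qed.

Lemma ip_ge0 u : 0 <= ip u u.
Proof.
have [->|u0] := eqVneq u 0; first by rewrite linear0l.
exact/ltW/neq0_dnorm_gt0.
Qed.

Lemma ipxx u : ip u u = `|u| ^+ 2.
Proof. by rewrite normE sqr_sqrtr// ip_ge0. Qed.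

Lemma ipDl u v w : ip (u + v) w = ip u w + ip v w.
Proof. exact: linearDl. Qed.
Lemma ipDr u v w : ip w (u + v) = ip w u + ip w v.
Proof. exact: linearDr. Qed.
Lemma ipNl u w : ip (- u) w = - ip u w.
Proof. exact: linearNl. Qed.
Lemma ipNr u w : ip w (- u) = - ip w u.
Proof. exact: linearNr. Qed.
Lemma ipZl a u w : ip (a *: u) w = a * ip u w.
Proof. exact: linearZl_LR. Qed.
Lemma ipZr a u w : ip w (a *: u) = a * ip w u.
Proof. by rewrite ipC ipZl ipC. Qed.
Definition ipE := (ipDl, ipDr, ipNl, ipNr, ipZl, ipZr).

Lemma norm_sqrD u v : `|u + v| ^+ 2 = `|u| ^+ 2 + 2 * ip u v + `|v| ^+ 2.
Proof. by rewrite -!ipxx !ipE [ip v u]ipC; ring. Qed.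

Lemma ip_polar u v : ip u v = (`|u + v| ^+ 2 - `|u| ^+ 2 - `|v| ^+ 2) / 2.
Proof. by rewrite norm_sqrD; field. Qed.

Lemma ip_le u v : ip u v <= `|u| * `|v|.
Proof.
have : `|u + v| ^+ 2 <= (`|u| + `|v|) ^+ 2.
  by rewrite ler_pXn2r ?nnegrE ?addr_ge0// ler_normD.
by rewrite norm_sqrD; lra.
Qed.

Lemma ip_ge u v : - (`|u| * `|v|) <= ip u v.
Proof. by have := ip_le (- u) v; rewrite ipNl normrN; lra. Qed.

Lemma cvg_ip (T : Type) (F : set_system T) (FF : Filter F) (a b : T -> X) l l' :
  a @ F --> l -> b @ F --> l' -> (ip (a t) (b t)) @[t --> F] --> ip l l'.
Proof.
move=> al bl; rewrite (_ : (fun t => _) = fun t =>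
  (`|a t + b t| * `|a t + b t| - `|a t| * `|a t| - `|b t| * `|b t|) * 2^-1).
  rewrite ip_polar !expr2; apply: cvgMl.
  by apply: cvgB; [apply: cvgB|]; apply: cvgM; apply: cvg_norm => //;
    exact: cvgD.
by apply/funext => t; rewrite ip_polar !expr2.
Qed.

Lemma ip_suml (I : Type) (s : seq I) (F : I -> X) w :
  ip (\sum_(i <- s) F i) w = \sum_(i <- s) ip (F i) w.
Proof.
elim: s => [|i s IH]; first by rewrite !big_nil linear0l.
by rewrite !big_cons ipDl IH.
Qed.

(** Gram-Schmidt; the conclusion is the part of orthonormality that provides
    coordinates bounded by the norm. *)
Lemma gram_schmidt n (e : 'I_n -> X) : exists s : seq X,
  [/\ forall v, v \in s -> `|v| = 1,
      forall v, v \in s -> v = \sum_(w <- s) ip v w *: w &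
      forall i, e i = \sum_(w <- s) ip (e i) w *: w].
Proof.
elim: n e => [|n IH] e; first by exists [::]; split => // -[].
have [s [s1 ss es]] := IH (fun i => e (widen_ord (leqnSn n) i)).
set u := e ord_max - \sum_(w <- s) ip (e ord_max) w *: w.
have eu : e ord_max = u + \sum_(w <- s) ip (e ord_max) w *: w by rewrite subrK.
have uv v : v \in s -> ip u v = 0.
  move=> vs; rewrite /u ipDl ipNl ip_suml {1}(ss _ vs) ipC ip_suml.
  apply/eqP; rewrite subr_eq0; apply/eqP; apply: eq_big_seq => w ws.
  by rewrite !ipZl [ip w _]ipC [ip w v]ipC mulrC.
have exp_u v : v = \sum_(w <- s) ip v w *: w -> ip v u = 0.
  move=> vE; rewrite vE ip_suml big_seq big1// => w ws.
  by rewrite ipZl [ip w u]ipC uv// mulr0.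
have [u0|u0] := eqVneq u 0.
  exists s; split=> // i.
  have [j ->|->] := unliftP ord_max i.
    rewrite (_ : lift ord_max j = widen_ord (leqnSn n) j); first exact: es.
    by apply: val_inj; rewrite /= /bump leqNgt ltn_ord.
  by move: eu; rewrite u0 add0r.
have nu : `|u| != 0 by rewrite normr_eq0.
pose w := `|u|^-1 *: u.
have ext v : v = \sum_(w <- s) ip v w *: w ->
  v = \sum_(w <- w :: s) ip v w *: w.
  by move=> vE; rewrite big_cons /w ipZr exp_u// mulr0 scale0r add0r.
exists (w :: s); split.
- move=> v; rewrite inE => /predU1P[->|]; last exact: s1.
  by rewrite /w normrZ normfV normr_id mulVf.
- move=> v; rewrite inE => /predU1P[->|vs]; last exact/ext/ss.
  rewrite big_cons big_seq big1 ?addr0; last first.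
    by move=> v' v's; rewrite /w ipZl uv// mulr0 scale0r.
  rewrite [ip w w](_ : _ = 1) ?scale1r//.
  by rewrite /w ipZl ipZr ipxx expr2; field.
- move=> i; have [j ->|->] := unliftP ord_max i.
    rewrite (_ : lift ord_max j = widen_ord (leqnSn n) j); first exact/ext/es.
    by apply: val_inj; rewrite /= /bump leqNgt ltn_ord.
  have eou : ip (e ord_max) u = `|u| ^+ 2.
    rewrite eu ipDl ip_suml big_seq big1 ?addr0 ?ipxx// => v vs.
    by rewrite ipZl [ip v u]ipC uv// mulr0.
  rewrite big_cons /w ipZr eou scalerA (_ : _ * _ = 1); last by field.
  by rewrite scale1r.
Qed.

Lemma orthonormal_expansion : is_euclidean ip ->
  exists s : seq X, (forall v, v \in s -> `|v| = 1) /\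
    forall x, x = \sum_(w <- s) ip x w *: w.
Proof.
move=> [_ [n [e gen]]]; have [s [s1 _ es]] := gram_schmidt e.
exists s; split=> // x; have [a ->] := gen x.
under [in RHS]eq_bigr do rewrite ip_suml scaler_suml.
rewrite exchange_big; apply: eq_bigr => i _ /=; rewrite {1}(es i) scaler_sumr.
by apply: eq_bigr => w _; rewrite ipZl scalerA.
Qed.

Lemma bounded_closed_compact_euclid (A : set X) : is_euclidean ip ->
  bounded_set A -> closed A -> compact A.
Proof.
move=> euclidX [M [Mreal AM]] clA.
have [s [s1 sE]] := orthonormal_expansion euclidX.
pose B := [set a : 'rV[R]_(size s) |
  forall i, a ord0 i \in `[- (M + 1), M + 1]].
have cB : compact B.
  apply: (@rV_compact _ _ (fun=> `[- (M + 1), (M + 1)]%classic)) => i.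
  exact: segment_compact.
pose Phi (a : 'rV[R]_(size s)) : X := \sum_(i < size s) a ord0 i *: s`_i.
have cPhi : continuous Phi.
  move=> a; rewrite /Phi; apply: (@cvg_big _ _ _ _ _ (@add_continuous _) _ (nbhs a)).
  by move=> i _; apply: cvgZr_tmp; exact: coord_continuous.
apply: (@subclosed_compact _ A (Phi @` B)) => //.
  by apply: continuous_compact cB; exact: continuous_subspaceT.
move=> x Ax; exists (\row_i ip x s`_i).
  move=> i; rewrite mxE in_itv /= -ler_norml.
  have sM : `|s`_i| = 1 by apply: s1; rewrite mem_nth.
  have xM : `|x| <= M + 1 by apply: AM => //; rewrite ltrDl.
  rewrite ler_norml; have := ip_le x s`_i; have := ip_ge x s`_i.
  by rewrite sM mulr1; lra.
rewrite [RHS]sE (big_nth 0) big_mkord; apply: eq_bigr => i _.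
by rewrite mxE.
Qed.

End InnerProduct.

Lemma compact_locally_bounded (R : realType) (T : topologicalType)
    (K : set T) (u : T -> R) : compact K ->
  (forall x, K x -> exists B, \forall y \near x, `|u y| <= B) ->
  exists B, forall x, K x -> `|u x| <= B.
Proof.
move=> cK loc.
apply: (@compact_induction _ K (fun A => exists B, forall x, A x -> `|u x| <= B)) => //.
- by exists 0.
- by move=> A B AB [M BM]; exists M => x /AB; exact: BM.
- move=> A B [M AM] [N BN]; exists (Num.max M N) => x [/AM|/BN] xM;
  by rewrite le_max xM ?orbT.
- by move=> x /loc[B xB]; exists [set y | `|u y| <= B] => //; exists B.
Qed.

Lemma cvg_harmonic_dist (R : realType) (V : normedModType R) (a b : nat -> V)
    (l : V) :
  a @ \oo --> l -> (forall n, `|b n - a n| <= n.+1%:R^-1) -> b @ \oo --> l.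
Proof.
move=> al ba; rewrite (_ : b = (fun n => (b n - a n) + a n)); last first.
  by apply/funext => n; rewrite subrK.
rewrite -[l]add0r; apply: cvgD => //; apply/norm_cvg0P.
apply: (@squeeze_cvgr _ _ _ _ (fun=> 0) (@harmonic R)).
- by apply: nearW => n; rewrite normr_ge0 /=; exact: ba.
- exact: cvg_cst.
- exact: cvg_harmonic.
Qed.

(** * Convex functions and the subdifferential of their opposites *)

Lemma convex_functionW (R : realType) (E : lmodType R) (D : set E) (f : E -> R) :
  convex_function D f -> forall t x y, 0 <= t <= 1 -> D x -> D y ->
  f (t *: x + (1 - t) *: y) <= t * f x + (1 - t) * f y.
Proof.
move=> cf t x y /andP[t0 t1] Dx Dy.
by have := cf (Itv01 t0 t1) x y; rewrite !inE => /(_ Dx Dy).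
Qed.

Section ConvexSubgradient.
Context {R : realType} {X : normedModType R} (ip : {dot X for (@idfun R)}).
Hypothesis euclidX : is_euclidean ip.
Variable (h : X -> R).
Hypothesis convex_h : convex_function (E := X) [set: X] h.

Let normE : forall x : X, `|x| = Num.sqrt (ip x x) := euclidX.1.

Let hW t x y : 0 <= t <= 1 -> h (t *: x + (1 - t) *: y) <= t * h x + (1 - t) * h y.
Proof. by move=> t01; exact: (convex_functionW convex_h). Qed.

Definition subgradient (x v : X) : Prop :=
  forall y, h x + ip v (y - x) <= h y.

Let convex_box_bounded (e : seq X) x : exists M r : R, 0 < r /\
  forall a : X -> R, (forall v, v \in e -> `|a v| <= r) ->
    h (x + \sum_(v <- e) a v *: v) <= M.
Proof.
elim: e => [|v e [M [r [r0 hM]]]].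
  by exists (h x), 1; split=> // a _; rewrite big_nil addr0.
pose M1 := Num.max (h (x + v)) (h (x - v)).
exists ((M1 + M) / 2), (Num.min (1 / 2) (r / 2)).
split=> [|a ar]; first by rewrite lt_min !divr_gt0.
have : `|a v| <= 1 / 2 by have := ar v (mem_head _ _); rewrite le_min => /andP[].
rewrite ler_norml => /andP[av1 av2].
have h1 : h (x + (2 * a v) *: v) <= M1.
  have -> : x + (2 * a v) *: v =
    (2^-1 + a v) *: (x + v) + (1 - (2^-1 + a v)) *: (x - v).
    rewrite !scalerDr !scalerN addrACA -scalerDl subrKC scale1r.
    by rewrite -scalerBl; congr (_ + _ *: _); field.
  apply: (@le_trans _ _ ((2^-1 + a v) * h (x + v) + (1 - (2^-1 + a v)) * h (x - v))).
    by apply: hW; lra.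
  have l1 : h (x + v) <= M1 by rewrite le_max lexx.
  have l2 : h (x - v) <= M1 by rewrite le_max lexx orbT.
  have : (2^-1 + a v) * h (x + v) <= (2^-1 + a v) * M1 by rewrite ler_wpM2l//; lra.
  have : (1 - (2^-1 + a v)) * h (x - v) <= (1 - (2^-1 + a v)) * M1.
    by rewrite ler_wpM2l//; lra.
  by lra.
have h2 : h (x + \sum_(w <- e) (2 * a w) *: w) <= M.
  apply: hM => w we; have := ar w; rewrite inE we orbT => /(_ isT).
  by rewrite le_min normrM gtr0_norm// => /andP[_]; lra.
rewrite big_cons.
have -> : x + (a v *: v + \sum_(w <- e) a w *: w) =
  2^-1 *: (x + (2 * a v) *: v) +
  (1 - 2^-1) *: (x + \sum_(w <- e) (2 * a w) *: w).
  rewrite (_ : 1 - 2^-1 = 2^-1); last by field.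
  rewrite -scalerDr addrACA !scalerDr -scalerDl.
  rewrite (_ : 2^-1 + 2^-1 = 1) ?scale1r; last by field.
  rewrite scalerA mulrA mulVf ?mul1r// scaler_sumr; congr (_ + (_ + _)).
  by apply: eq_bigr => w _; rewrite scalerA mulrA mulVf ?mul1r.
apply: (le_trans (hW _ _ _)); first lra.
by lra.
Qed.

(** Near x, h is bounded above, being convex on small boxes; two applications
    of convexity on lines through x turn this bound into continuity. *)
Lemma convex_continuous : continuous h.
Proof.
have [s [s1 sE]] := orthonormal_expansion normE euclidX.
move=> x; have [M [r [r0 hM0]]] := convex_box_bounded s x.
have hM y : `|y - x| <= r -> h y <= M.
  move=> yxr; rewrite -[y](subrKC x) [y - x]sE; apply: hM0 => v vs.
  rewrite ler_norml; have := ip_le normE (y - x) v.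
  by have := ip_ge normE (y - x) v; rewrite (s1 _ vs) mulr1; lra.
have hxM : h x <= M by apply: hM; rewrite subrr normr0 ltW.
have M0 : 0 < M - h x + 1 by lra.
apply/cvgrPdist_le => /= e e0.
pose t := Num.min 1 (e / (M - h x + 1)).
have t0 : 0 < t by rewrite lt_min ltr01 divr_gt0.
have t1 : t <= 1 by rewrite ge_min lexx.
have te : t * (M - h x) <= e.
  apply: (@le_trans _ _ (t * (M - h x + 1))); first by rewrite ler_pM2l//; lra.
  by rewrite -ler_pdivlMr// ge_min lexx orbT.
near=> y.
have yx : `|y - x| <= t * r.
  rewrite distrC; near: y; apply: cvgr_dist_le; last by rewrite mulr_gt0.
  exact: cvg_id.
pose d := t^-1 *: (y - x).
have dr : `|d| <= r by rewrite normrZ gtr0_norm ?invr_gt0// ler_pdivrMl.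
have td : t *: d = y - x by rewrite /d scalerA divff ?scale1r// gt_eqF.
have up : h y <= t * M + (1 - t) * h x.
  have -> : y = t *: (x + d) + (1 - t) *: x.
    by rewrite scalerDr td scalerBl scale1r [t *: x + _]addrC addrACA subrK subrr addr0.
  apply: (le_trans (hW _ _ _)); first lra.
  rewrite lerD2r ler_pM2l//; apply: hM; by rewrite addrAC subrr add0r.
have lo : (1 + t) * h x <= h y + t * M.
  have t10 : 0 < 1 + t by lra.
  have xE : x = (1 + t)^-1 *: y + (1 - (1 + t)^-1) *: (x - d).
    rewrite (_ : 1 - (1 + t)^-1 = (1 + t)^-1 * t); last by field; rewrite gt_eqF.
    rewrite -scalerA -scalerDr scalerBr td.
    rewrite (_ : y + (t *: x - (y - x)) = (1 + t) *: x).
      by rewrite scalerA mulVf ?scale1r// gt_eqF.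
    by rewrite scalerDl scale1r opprB addrCA subrKC addrC.
  have : h x <= (1 + t)^-1 * h y + (1 - (1 + t)^-1) * h (x - d).
    rewrite {1}xE; apply: hW; rewrite invr_ge0 invf_le1//; apply/andP; split; lra.
  have hd : h (x - d) <= M by apply: hM; rewrite addrAC subrr add0r normrN.
  move=> hx1; have : (1 + t) * h x <= h y + t * h (x - d).
    rewrite -(ler_pM2l t10) in hx1; apply: (le_trans hx1).
    by rewrite le_eqVlt; apply/predU1P; left; field; rewrite gt_eqF.
  have : t * h (x - d) <= t * M by rewrite ler_pM2l.
  by lra.
by rewrite ler_norml; apply/andP; split; lra.
Unshelve. all: by end_near. Qed.

(** Below, - h must stay above its supporting affine function up to o(|y - x|);
    reflecting through x, convexity of h turns this into a global support from
    below of h by the opposite slope. *)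
Lemma regular_neg_subgradient x v :
  regular_subdiff ip (neg_fun h) x v -> subgradient x (- v).
Proof.
move=> [_ reg] y; pose d := y - x.
apply/ler_addgt0Pr => e e0.
have d1 : 0 < `|d| + 1 by rewrite ltr_wpDl.
pose eps := e / (`|d| + 1).
have eps0 : 0 < eps by rewrite divr_gt0.
have /nbhs_ballP[r /= r0 rb] := reg _ eps0.
pose t := Num.min 1 (r / (`|d| + 1) / 2).
have t0 : 0 < t by rewrite lt_min ltr01 !divr_gt0.
have t10 : 0 < 1 + t by lra.
have td : `|t *: d| < r.
  rewrite normrZ gtr0_norm//; apply: (@le_lt_trans _ _ (r / (`|d| + 1) / 2 * (`|d| + 1))).
    by apply: ler_pM; rewrite ?(ltW t0) ?normr_ge0 ?ge_min ?lexx ?orbT ?lerDl ?ler01.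
  by rewrite (_ : _ * _ = r / 2); [lra|field; rewrite gt_eqF].
have := rb (x - t *: d); rewrite -ball_normE /= opprB addrC subrK => /(_ td).
rewrite /neg_fun /= -EFinD lee_fin addrAC subrr add0r /ipnorm -normE normrN.
rewrite normrZ gtr0_norm//.
rewrite ipNr ipZr => h1.
have : h x <= (1 + t)^-1 * h (x - t *: d) + (1 - (1 + t)^-1) * h y.
  rewrite {1}(_ : x = (1 + t)^-1 *: (x - t *: d) + (1 - (1 + t)^-1) *: y).
    apply: hW; rewrite invr_ge0 invf_le1//; apply/andP; split; lra.
  rewrite (_ : 1 - (1 + t)^-1 = (1 + t)^-1 * t); last by field; rewrite gt_eqF.
  rewrite -scalerA -scalerDr /d scalerBr opprB addrA subrK.
  by rewrite -{2}[x]scale1r -scalerDl scalerA mulVf ?scale1r// gt_eqF.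
move=> hx1; have h2 : (1 + t) * h x <= h (x - t *: d) + t * h y.
  rewrite -(ler_pM2l t10) in hx1; apply: (le_trans hx1).
  by rewrite le_eqVlt; apply/predU1P; left; field; rewrite gt_eqF.
rewrite ipNl -/d.
have h3 : eps * `|d| <= e.
  by rewrite /eps -mulrA ler_piMr ?ltW// ltr_pdivrMl// mulr1; lra.
rewrite -(ler_pM2l t0).
have : t * (eps * `|d|) <= t * e by rewrite ler_pM2l.
by lra.
Qed.

(** Global supports survive limits. *)
Lemma limiting_neg_subgradient x v :
  limiting_subdiff ip (neg_fun h) x v -> subgradient x (- v).
Proof.
move=> [_ [xs [vs [xsx _ vsv reg]]]] y.
have c1 : (fun n => h (xs n) + ip (- vs n) (y - xs n)) @ \oo --> h x + ip (- v) (y - x).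
  apply: cvgD; first by apply: continuous_cvg => //; exact: convex_continuous.
  by apply: (cvg_ip normE); [exact: cvgN|apply: cvgB => //; exact: cvg_cst].
rewrite -(cvg_lim (@Rhausdorff R) c1); apply: limr_le.
  by apply/cvg_ex; eexists; exact: c1.
by apply: nearW => n; exact: regular_neg_subgradient.
Qed.

(** A diagonal choice of regular subgradients; the values converge because h is
    continuous. *)
Lemma limiting_neg_closed (xs vs : nat -> X) x v :
  xs @ \oo --> x -> vs @ \oo --> v ->
  (forall n, limiting_subdiff ip (neg_fun h) (xs n) (vs n)) ->
  limiting_subdiff ip (neg_fun h) x v.
Proof.
move=> xsx vsv lim; split => //.
have ex n : exists yw : X * X, [/\ `|yw.1 - xs n| <= n.+1%:R^-1,
    `|yw.2 - vs n| <= n.+1%:R^-1 & regular_subdiff ip (neg_fun h) yw.1 yw.2].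
  have [_ [ys [ws [ysx _ wsv reg]]]] := lim n.
  have n0 : 0 < n.+1%:R^-1 :> R by rewrite invr_gt0 ltr0n.
  have near_yw : \forall k \near \oo, `|xs n - ys k| <= n.+1%:R^-1 /\
      `|vs n - ws k| <= n.+1%:R^-1.
    near=> k; split; near: k; exact: cvgr_dist_le.
  have [k [k1 k2]] := filter_ex near_yw.
  by exists (ys k, ws k); split; rewrite /= 1?distrC.
have [yw ywP] := choice ex.
have c1 : (fun n => (yw n).1) @ \oo --> x.
  by apply: cvg_harmonic_dist xsx _ => n; have [] := ywP n.
exists (fun n => (yw n).1), (fun n => (yw n).2); split => //.
- apply: cvg_EFin; first exact: nearW.
  by apply: cvgN; apply: continuous_cvg => //; exact: convex_continuous.
- by apply: cvg_harmonic_dist vsv _ => n; have [] := ywP n.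
- by move=> n; have [] := ywP n.
Unshelve. all: by end_near. Qed.

(** Testing the subgradient inequality one unit along the subgradient. *)
Lemma subgradient_bound (r B : R) x v : (forall y, `|y| <= r + 1 -> `|h y| <= B) ->
  `|x| <= r -> subgradient x v -> `|v| <= 2 * B.
Proof.
move=> hB xr sub.
have hx : `|h x| <= B by apply: hB; lra.
have [->|v0] := eqVneq v 0; first by have := normr_ge0 (h x); rewrite normr0; lra.
have nv : `|v| != 0 by rewrite normr_eq0.
have := sub (x + `|v|^-1 *: v); rewrite [x + _]addrC addrK ipZr (ipxx normE).
rewrite expr2 mulKf// => h1.
have : `|h (`|v|^-1 *: v + x)| <= B.
  apply: hB; apply: (le_trans (ler_normD _ _)).
  by rewrite normrZ normfV normr_id mulVf//; lra.
by move: hx; rewrite !ler_norml; lra.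
Qed.

Lemma conjugate_ge x v : ((ip v x - h x)%:E <= convex_conjugate ip h v)%E.
Proof. by apply: ereal_sup_ubound; exists x. Qed.

Lemma conjugate_subgradient x v : subgradient x v ->
  convex_conjugate ip h v = (ip v x - h x)%:E.
Proof.
move=> sub; apply/eqP; rewrite eq_le conjugate_ge andbT.
apply: ub_ereal_sup => _ [y _ <-]; rewrite lee_fin.
by have := sub y; rewrite ipDr ipNr; lra.
Qed.

End ConvexSubgradient.

(** * Nonmonotone descent in a sliding window *)

Section NonmonotoneDescent.
Context {R : realType}.
Variables (F D : nat -> R) (m : nat) (a L b : R).
Hypotheses (a0 : 0 < a) (L0 : 0 <= L) (D0 : forall k, 0 <= D k)
  (dec : forall k, exists i, [/\ (k - m <= i)%N, (i <= k)%N &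
                               F k.+1 + a * D k ^+ 2 <= F i])
  (inc : forall k, F k.+1 <= F k + L * D k ^+ 2)
  (lowF : forall k, b <= F k).

Lemma window_argmax : exists l : nat -> nat, forall k,
  [/\ (k - m <= l k)%N, (l k <= k)%N &
      forall i, (k - m <= i <= k)%N -> F i <= F (l k)].
Proof.
have max k n : (n <= k)%N -> exists l, [/\ (n <= l)%N, (l <= k)%N &
    forall i, (n <= i <= k)%N -> F i <= F l].
  elim: k => [|k IH] nk.
    exists 0%N; split=> // i /andP[_]; rewrite leqn0 => /eqP ->; exact: lexx.
  have [e|nk1] := eqVneq n k.+1.
    exists k.+1; rewrite e; split=> // i; rewrite -eqn_leq => /eqP <-; exact: lexx.
  have [|l [nl lk lmax]] := IH; first by rewrite -ltnS ltn_neqAle nk1 nk.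
  have [ll|ll] := leP (F k.+1) (F l).
    exists l; split=> //; first exact: leqW.
    move=> i /andP[ni]; rewrite leq_eqVlt => /predU1P[->//|ik].
    by apply: lmax; rewrite ni.
  exists k.+1; split=> // i /andP[ni]; rewrite leq_eqVlt => /predU1P[->//|ik].
  by apply: (le_trans _ (ltW ll)); apply: lmax; rewrite ni.
have /choice[l lP] : forall k, exists l, [/\ (k - m <= l)%N, (l <= k)%N &
    forall i, (k - m <= i <= k)%N -> F i <= F l].
  by move=> k; apply: max; exact: leq_subr.
by exists l.
Qed.

Variable (l : nat -> nat).
Hypothesis lP : forall k, [/\ (k - m <= l k)%N, (l k <= k)%N &
  forall i, (k - m <= i <= k)%N -> F i <= F (l k)].

Let M k := F (l k).

Lemma le_window_max k : F k <= M k.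
Proof. by have [_ _] := lP k; apply; rewrite leq_subr leqnn. Qed.

Lemma window_descent k : F k.+1 + a * D k ^+ 2 <= M k.
Proof.
have [i [mi ik /le_trans]] := dec k; apply.
by have [_ _] := lP k; apply; rewrite mi.
Qed.

Let window_step k : F k.+1 <= M k.
Proof.
apply: le_trans (window_descent k); rewrite lerDl.
by apply: mulr_ge0; [exact: ltW|exact: exprn_ge0].
Qed.

Lemma window_max_noninc k j : (k <= j)%N -> M j <= M k.
Proof.
elim: j => [|j IH]; first by rewrite leqn0 => /eqP ->.
rewrite leq_eqVlt => /predU1P[->//|kj]; apply: (le_trans _ (IH kj)).
have [mlj lj _] := lP j.+1; move: lj; rewrite /M leq_eqVlt.
move=> /predU1P[->|lj]; first exact: window_step.
have [_ _] := lP j; apply; apply/andP; split; last by rewrite -ltnS.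
by rewrite (leq_trans _ mlj)// leq_sub2r.
Qed.

(** From the index l k of the maximum one walks back through the window: by
    inc, F cannot drop much below F (l k) in one backward step, and by the
    window descent the step length is paid for by the decrease of the maximum.
    Each backward step costs a factor 1 + L / a. *)
Lemma step_le_window_drop i :
  D i ^+ 2 <= (1 + L / a) ^+ m / a * (M i - M (i + m.+1)%N).
Proof.
set k := (i + m.+1)%N; pose c := 1 + L / a; pose E := M i - M k.
have c1 : 1 <= c by rewrite lerDl divr_ge0// ltW.
have E0 : 0 <= E by rewrite subr_ge0 window_max_noninc// leq_addr.
have [ml lk _] := lP k.
have il : (i < l k)%N by move: ml; rewrite /k addnS subSn ?addnK// leq_addl.
have stepD j t : (i <= j)%N -> M k - (c ^+ t - 1) * E <= F j.+1 ->
    D j ^+ 2 <= c ^+ t / a * E.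
  move=> ij Fj; have := window_descent j.
  have := window_max_noninc ij; rewrite [_ / a]mulrC -mulrA ler_pdivlMl//.
  by move: Fj; rewrite /E; lra.
have back t : (t <= l k - i)%N -> M k - (c ^+ t - 1) * E <= F (l k - t)%N.
  elim: t => [|t IH] ti; first by rewrite expr0 subrr mul0r !subr0 subn0.
  have {}IH := IH (ltnW ti).
  have lt1 : (l k - t = (l k - t.+1).+1)%N.
    by rewrite -subnSK// (leq_trans ti)// leq_subr.
  rewrite lt1 in IH.
  have ij : (i <= l k - t.+1)%N.
    by rewrite leq_subRL; [rewrite addnC -leq_subRL ?(ltnW il)|
      rewrite (leq_trans ti)// leq_subr].
  have Dj := stepD _ _ ij IH; have incj := inc (l k - t.+1).
  have : L * D (l k - t.+1)%N ^+ 2 <= L * (c ^+ t / a * E) by rewrite ler_wpM2l.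
  have -> : (c ^+ t.+1 - 1) * E = (c ^+ t - 1) * E + L * (c ^+ t / a * E).
    by rewrite exprSr /c; field; rewrite gt_eqF.
  by lra.
have tm : (l k - i.+1 <= m)%N.
  by rewrite leq_subLR (leq_trans lk)// /k addnS addSn.
have := back (l k - i.+1)%N; rewrite leq_sub2l// subKn// => /(_ isT).
move=> /(stepD _ _ (leqnn i))/le_trans; apply.
rewrite -/c -/E ler_wpM2r// ler_pM2r ?invr_gt0//.
by rewrite ler_weXn2l.
Qed.

Lemma window_max_cvg : exists2 Fs : R, M @ \oo --> Fs & forall k, Fs <= M k.
Proof.
have nM : nonincreasing_seq M by move=> i j; exact: window_max_noninc.
have cM : cvgn M.
  by apply: nonincreasing_is_cvgn => //; exists b => _ [n _ <-]; exact: lowF.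
by exists (limn M) => // k; exact: nonincreasing_cvgn_ge.
Qed.

Lemma window_drop_cvg0 : (fun i => M i - M (i + m.+1)%N) @ \oo --> (0 : R).
Proof.
have [Fs MFs _] := window_max_cvg; rewrite -(subrr Fs); apply: cvgB => //.
by rewrite (cvg_shiftn m.+1 M).
Qed.

Lemma step_sqr_cvg0 : (fun i => D i ^+ 2) @ \oo --> (0 : R).
Proof.
pose C := (1 + L / a) ^+ m / a.
apply: (@squeeze_cvgr _ _ _ _ (fun=> 0) (fun i => C * (M i - M (i + m.+1)%N))).
- by apply: nearW => i; rewrite exprn_ge0//= step_le_window_drop.
- exact: cvg_cst.
- by rewrite -(mulr0 C); apply: cvgMl_tmp; exact: window_drop_cvg0.
Qed.

(** Inside each window F stays between the maximum and the maximum minus a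
    multiple of the vanishing step lengths, so F has the limit of the
    maxima. *)
Lemma window_values_cvg (Fs : R) : M @ \oo --> Fs -> F @ \oo --> Fs.
Proof.
move=> MFs.
pose low j n := M (n + m)%N - L * \sum_(0 <= s < j) D (n + s)%N ^+ 2.
have lowF' n : low m n <= F n.
  have sumD s : (s <= m)%N ->
      F (n + s)%N <= F n + L * \sum_(0 <= t < s) D (n + t)%N ^+ 2.
    elim: s => [|s IH] sm; first by rewrite addn0 big_geq// mulr0 addr0.
    rewrite big_nat_recr//= addnS; have := IH (ltnW sm); have := inc (n + s).
    by lra.
  have [ml lk _] := lP (n + m); rewrite addnK in ml.
  have lm : (l (n + m) - n <= m)%N by rewrite leq_subLR.
  have := sumD _ lm; rewrite subnKC// /low /M => /le_trans H.
  rewrite lerBlDr; apply: H; rewrite lerD2l ler_wpM2l//.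
  rewrite (big_cat_nat (leq0n _) lm)//= lerDl; apply: sumr_ge0 => t _.
  by rewrite exprn_ge0.
apply: (@squeeze_cvgr _ _ _ _ (low m) M).
- by apply: nearW => n; rewrite lowF' le_window_max.
- rewrite /low -[Fs in X in _ --> X]subr0; apply: cvgB.
    by rewrite (cvg_shiftn m M).
  rewrite -[0 in X in _ --> X](mulr0 L); apply: cvgMl_tmp.
  elim: m => [|j IH].
    rewrite (_ : (fun n => _) = fun=> 0); first exact: cvg_cst.
    by apply/funext => n; rewrite big_geq.
  rewrite (_ : (fun n => _) = fun n => \sum_(0 <= s < j) D (n + s)%N ^+ 2 +
    D (n + j)%N ^+ 2); last by apply/funext => n; rewrite big_nat_recr.
  rewrite -[0 in X in _ --> X]addr0; apply: cvgD => //.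
  by rewrite (cvg_shiftn j (fun i => D i ^+ 2)); exact: step_sqr_cvg0.
- exact: MFs.
Qed.

End NonmonotoneDescent.

(** * Summability and rates from a Kurdyka-Lojasiewicz recursion *)

(** The features of a desingularizing function phi that the convergence proof
    uses, with psi in the role of its derivative.  Such pairs can be added
    without regard to differentiability, which is how finitely many local
    functions are merged into one. *)
Definition gauge (R : realType) (eta : R) (phi psi : R -> R) : Prop :=
  [/\ forall t, 0 <= t < eta -> 0 <= phi t,
      forall t, 0 < t < eta -> 0 < psi t &
      forall s t, 0 <= s < eta -> 0 < t < eta ->
        phi s <= phi t + psi t * (s - t)].

Section Gauge.
Context {R : realType}.
Implicit Types (eta s t : R) (phi psi : R -> R).

Lemma gauge_antitone eta phi psi s t : gauge eta phi psi ->
  0 < s -> s <= t -> t < eta -> psi t <= psi s.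
Proof.
move=> [_ _ g] s0 st te; have [->//|nst] := eqVneq s t.
have st' : s < t by rewrite lt_neqAle nst.
have s1 : 0 < s < eta by rewrite s0 (le_lt_trans st).
have t1 : 0 < t < eta by rewrite te (lt_le_trans s0).
have s2 : 0 <= s < eta by move: s1 => /andP[/ltW -> ->].
have t2 : 0 <= t < eta by move: t1 => /andP[/ltW -> ->].
have := g s t s2 t1; have := g t s t2 s1 => h1 h2.
have ts : 0 < t - s by rewrite subr_gt0.
rewrite -(ler_pM2r ts); lra.
Qed.

Lemma gauge_nondecreasing eta phi psi s t : gauge eta phi psi ->
  0 <= s -> s <= t -> t < eta -> phi s <= phi t.
Proof.
move=> [_ gp g] s0 st te; have [->//|nst] := eqVneq s t.
have st' : s < t by rewrite lt_neqAle nst.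
have t1 : 0 < t < eta by rewrite te (le_lt_trans s0).
apply: (le_trans (g s t _ t1)); first by rewrite s0 (le_lt_trans st).
by rewrite gerDl pmulr_rle0 ?subr_le0// gp.
Qed.

Lemma gauge_slope_le eta phi psi t : gauge eta phi psi ->
  0 < t < eta -> psi t <= phi t / t.
Proof.
move=> [gp _ g] t1; have /andP[t0 te] := t1.
have z : (0 : R) <= 0 < eta by rewrite lexx (lt_trans t0).
by rewrite ler_pdivlMr//; have := g 0 t z t1; have := gp 0 z; lra.
Qed.

Lemma gaugeD eta1 eta2 phi1 psi1 phi2 psi2 :
  gauge eta1 phi1 psi1 -> gauge eta2 phi2 psi2 ->
  gauge (Num.min eta1 eta2) (fun t => phi1 t + phi2 t)
    (fun t => psi1 t + psi2 t).
Proof.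
move=> [p1 q1 g1] [p2 q2 g2]; split.
- by move=> t; rewrite lt_min => /and3P[? ? ?]; rewrite addr_ge0 ?p1 ?p2//; exact/andP.
- by move=> t; rewrite lt_min => /and3P[? ? ?]; rewrite addr_gt0 ?q1 ?q2//; exact/andP.
- move=> s t; rewrite !lt_min => /and3P[s0 s1 s2] /and3P[t0 t1 t2].
  have := g1 s t; rewrite s0 s1 t0 t1 => /(_ isT isT).
  by have := g2 s t; rewrite s0 s2 t0 t2 => /(_ isT isT); lra.
Qed.

End Gauge.

Section KLRecursion.
Context {R : realType}.
Variables (r : nat -> R) (N : nat) (eta b : R) (phi psi : R -> R) (K : nat).
Hypotheses (gau : gauge eta phi psi) (r0 : forall k, 0 <= r k)
  (noninc : forall i j, (i <= j)%N -> r j <= r i) (b0 : 0 <= b) (rK : r K < eta)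
  (KLr : forall k, (K <= k)%N -> 0 < r (k + N)%N ->
     1 <= psi (r (k + N)%N) * (b * Num.sqrt (r k - r (k + N)%N))).

Let S k := Num.sqrt (r k - r (k + N)%N).

Let S_ge0 k : 0 <= S k. Proof. exact: sqrtr_ge0. Qed.

Let S_sqr k : S k ^+ 2 = r k - r (k + N)%N.
Proof. by rewrite sqr_sqrtr// subr_ge0 noninc// leq_addr. Qed.

Let lt_eta k : (K <= k)%N -> r k < eta.
Proof. by move=> Kk; apply: le_lt_trans rK; exact: noninc. Qed.

(** Concavity turns the recursion into S (k + N) ^+ 2 <= b * S k * (decrease of
    phi), and the inequality of arithmetic and geometric means separates the
    two factors. *)
Let S_step k : (K <= k)%N ->
  2 * S (k + N)%N <= S k + b * (phi (r (k + N)%N) - phi (r (k + N + N)%N)).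
Proof.
move=> Kk; have [_ gpsi gc] := gau.
have KkN : (K <= k + N)%N by rewrite (leq_trans Kk)// leq_addr.
have le2 : r (k + N + N)%N <= r (k + N)%N by rewrite noninc// leq_addr.
have dphi : 0 <= phi (r (k + N)%N) - phi (r (k + N + N)%N).
  by rewrite subr_ge0 (gauge_nondecreasing gau)// lt_eta.
have [rz|rn] := eqVneq (r (k + N)%N) 0.
  have : S (k + N)%N = 0.
    by rewrite /S rz ler0_sqrtr// subr_le0.
  by move=> ->; rewrite mulr0 addr_ge0// mulr_ge0.
have rp : 0 < r (k + N)%N by rewrite lt_def rn r0.
have rp1 : 0 < r (k + N)%N < eta by rewrite rp lt_eta.
have := gc (r (k + N + N)%N) _ _ rp1; rewrite r0 lt_eta; last first.
  by rewrite (leq_trans KkN)// leq_addr.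
move=> /(_ isT); set d := phi _ - _ in dphi *; set p := psi _ => hc.
have {}hc : p * S (k + N)%N ^+ 2 <= d by rewrite S_sqr /d; lra.
have p0 : 0 < p by exact: gpsi.
have kl : 1 <= p * (b * S k) := KLr Kk rp.
have h : S (k + N)%N ^+ 2 <= S k * (b * d).
  apply: (@le_trans _ _ (p * (b * S k) * S (k + N)%N ^+ 2)).
    by rewrite ler_peMl// exprn_ge0.
  apply: (@le_trans _ _ (S k * (b * (p * S (k + N)%N ^+ 2)))); first lra.
  by rewrite ler_wpM2l// ler_wpM2l.
have bd : 0 <= b * d by rewrite mulr_ge0.
rewrite -(@ler_pXn2r _ 2)// ?nnegrE ?mulr_ge0 ?addr_ge0//.
by have := sqr_ge0 (S k - b * d); move: h; lra.
Qed.

(** The step estimate compares S at k and at k + N.  Summing it over a window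
    turns it into the decrease of one quantity between consecutive indices. *)
Let W k := \sum_(0 <= i < N) (2 * S (k + i)%N + b * phi (r (k + i + N)%N)).

Let W_decrease k : (K <= k)%N -> W k.+1 + S k <= W k.
Proof.
move=> Kk; pose u i := 2 * S (k + i)%N + b * phi (r (k + i + N)%N).
have -> : W k.+1 = \sum_(0 <= i < N) u i.+1.
  by apply: eq_bigr => i _; rewrite /u addnS addSn.
have -> : W k = \sum_(0 <= i < N) u i by [].
have : \sum_(0 <= i < N) u i + u N = u 0%N + \sum_(0 <= i < N) u i.+1.
  by rewrite -big_nat_recr// -big_nat_recl.
by have := S_step Kk; rewrite /u addn0; lra.
Qed.

(** The potential telescopes, and its value at j involves r j only. *)
Lemma KL_tail_le j n : (K <= j)%N ->
  \sum_(j <= k < n) Num.sqrt (r k - r (k + N)%N) <=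
    N%:R * (2 * Num.sqrt (r j) + b * phi (r j)).
Proof.
have [gphi _ _] := gau.
have phi_ge0 k : (K <= k)%N -> 0 <= phi (r k) by move=> /lt_eta ?; rewrite gphi// r0.
have W_ge0 k : (K <= k)%N -> 0 <= W k.
  move=> Kk; apply: sumr_ge0 => i _; rewrite addr_ge0 ?mulr_ge0 ?phi_ge0//.
  by rewrite (leq_trans Kk)// -addnA leq_addr.
move=> Kj; apply: (@le_trans _ _ (W j)).
  have [nj|jn] := leqP n j; first by rewrite big_geq// W_ge0.
  have sumW p : \sum_(j <= k < j + p) S k + W (j + p)%N <= W j.
    elim: p => [|p IH]; first by rewrite addn0 big_geq// add0r.
    rewrite addnS big_nat_recr ?leq_addr//=.
    have Kp : (K <= j + p)%N by rewrite (leq_trans Kj)// leq_addr.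
    by have := W_decrease Kp; move: IH; lra.
  have := sumW (n - j)%N; rewrite subnKC ?(ltnW jn)//.
  have : 0 <= W n by rewrite W_ge0// (leq_trans Kj)// ltnW.
  by rewrite /S; lra.
rewrite /W mulr_natl -[N in leRHS]subn0.
rewrite -(sumr_const_nat N 0 (2 * Num.sqrt (r j) + b * phi (r j))).
apply: ler_sum => i _.
apply: lerD.
  rewrite ler_pM2l// /S ler_sqrt ?r0//; apply: (@le_trans _ _ (r (j + i)%N)).
    by rewrite gerBl r0.
  by rewrite noninc// leq_addr.
rewrite ler_wpM2l// (gauge_nondecreasing gau)// ?lt_eta// noninc//.
by rewrite -addnA leq_addr.
Qed.

End KLRecursion.

Section Rates.
Context {R : realType}.
Variables (r : nat -> R) (N : nat) (K : nat).
Hypotheses (N0 : (0 < N)%N) (r0 : forall k, 0 <= r k)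
  (noninc : forall i j, (i <= j)%N -> r j <= r i) (rK1 : r K <= 1).

Let r_le1 k : (K <= k)%N -> r k <= 1.
Proof. by move=> Kk; apply: le_trans rK1; exact: noninc. Qed.

(** Since psi t <= phi t / t = c * t `^ (- theta), the recursion bounds
    r (k + N) `^ theta by a multiple of a square root, and can be squared. *)
Lemma KL_power_recursion (b c theta eta : R) (phi psi : R -> R) :
  gauge eta phi psi -> 0 <= b -> 0 < c ->
  0 < theta < 1 -> (forall t, 0 < t -> phi t = c * t `^ (1 - theta)) ->
  r K < eta ->
  (forall k, (K <= k)%N -> 0 < r (k + N)%N ->
     1 <= psi (r (k + N)%N) * (b * Num.sqrt (r k - r (k + N)%N))) ->
  forall k, (K <= k)%N ->
    r (k + N)%N `^ (2 * theta) <= (c * b) ^+ 2 * (r k - r (k + N)%N).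
Proof.
move=> gau b0 c0 /andP[th0 th1] phiE rKe kl k Kk.
have dr : 0 <= r k - r (k + N)%N by rewrite subr_ge0 noninc// leq_addr.
have [rz|rn] := eqVneq (r (k + N)%N) 0.
  rewrite rz in dr *; rewrite powR0; last by rewrite mulf_neq0// gt_eqF.
  by rewrite mulr_ge0// sqr_ge0.
have rp : 0 < r (k + N)%N by rewrite lt_def rn r0.
set t := r (k + N)%N in rp *.
have te : 0 < t < eta.
  by rewrite rp (le_lt_trans _ rKe)// noninc// (leq_trans Kk)// leq_addr.
have tth : 0 < t `^ theta by exact: powR_gt0.
have psile : psi t * t `^ theta <= c.
  rewrite -ler_pdivlMr//; apply: (le_trans (gauge_slope_le gau te)).
  rewrite phiE// powRB ?rn ?implybT// powRr1 ?(ltW rp)//.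
  by rewrite le_eqVlt; apply/predU1P; left; field; rewrite !gt_eqF.
have h : t `^ theta <= c * b * Num.sqrt (r k - t).
  have kt := kl _ Kk rp; rewrite -/t in kt.
  set S := Num.sqrt _ in kt *; have S0 : 0 <= S := sqrtr_ge0 _.
  apply: (@le_trans _ _ (psi t * (b * S) * t `^ theta)).
    by rewrite ler_peMl// ltW.
  apply: (@le_trans _ _ (psi t * t `^ theta * (b * S))); first lra.
  by rewrite -[leRHS]mulrA ler_wpM2r// mulr_ge0.
have -> : t `^ (2 * theta) = (t `^ theta) ^+ 2.
  by rewrite mulrC powRrM -powR_mulrn ?powR_ge0.
rewrite -[r k - t]sqr_sqrtr// -exprMn ler_pXn2r// nnegrE ?powR_ge0//.
by rewrite mulr_ge0 ?sqrtr_ge0// mulr_ge0// ltW.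
Qed.

Lemma linear_decay (C : R) : 0 < C ->
  (forall k, (K <= k)%N -> r (k + N)%N <= C * (r k - r (k + N)%N)) ->
  exists B q, [/\ 0 < B, 0 < q < 1 &
    forall k, (K <= k)%N -> r k <= B * (q ^+ k) ^+ 2].
Proof.
move=> C0 rec.
pose tau := C / (1 + C); have C1 : 0 < 1 + C by lra.
have tau0 : 0 < tau by rewrite divr_gt0.
have tau1 : tau < 1 by rewrite ltr_pdivrMr// mul1r; lra.
have recT k : (K <= k)%N -> r (k + N)%N <= tau * r k.
  by move=> /rec; rewrite /tau mulrAC ler_pdivlMr//; lra.
have N2 : (0 : R) < (2 * N)%:R by rewrite ltr0n muln_gt0.
pose q := tau `^ ((2 * N)%:R^-1).
have q0 : 0 < q by exact: powR_gt0.
have q1 : q < 1.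
  have <- : 1 `^ (2 * N)%:R^-1 = 1 :> R by rewrite powR1.
  by rewrite gt0_ltr_powR ?invr_gt0 ?nnegrE ?ler01 ?(ltW tau0).
have qN : q ^+ (2 * N) = tau.
  by rewrite -powR_mulrn ?(ltW q0)// -powRrM mulVf ?powRr1 ?gt_eqF// ltW.
have sqrq k : (q ^+ k) ^+ 2 = q ^+ (2 * k) by rewrite -exprM mulnC.
pose B := (r K + 1) / q ^+ (2 * (K + N)).
have B0 : 0 < B by rewrite divr_gt0 ?exprn_gt0// ltr_wpDl.
exists B, q; split; [by []|by rewrite q0|].
elim/ltn_ind => k IH Kk; rewrite sqrq.
have [kKN|KNk] := leqP k (K + N).
  apply: (@le_trans _ _ (r K + 1)); first by rewrite (le_trans (noninc Kk))// lerDl.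
  rewrite /B -mulrA ler_peMr ?addr_ge0//.
  rewrite mulrC ler_pdivlMr ?exprn_gt0// mul1r.
  by apply: ler_wiXn2l; rewrite ?(ltW q0) ?(ltW q1) ?leq_mul2l ?kKN ?orbT.
have Nk : (N <= k)%N by rewrite (leq_trans _ (ltnW KNk))// leq_addl.
have KkN : (K <= k - N)%N by rewrite leq_subRL// addnC ltnW.
have := recT _ KkN; rewrite subnK// => /le_trans; apply.
have : (k - N < k)%N by rewrite ltn_subrL N0 (leq_trans _ KNk).
move=> /IH/(_ KkN); rewrite sqrq -(ler_pM2l tau0) => /le_trans; apply.
rewrite -qN mulrCA -exprD -mulnDr subnKC//.
Qed.

(** Put s = 2 * theta - 1 and let t be the ratio of the later term to the earlier
    one.  As - ln t >= 1 - t, the growth factor t ^ (- s) is at least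
    1 + s * (1 - t).  This is a fixed growth if t <= 1/2; otherwise the two terms
    are comparable and the recursion bounds 1 - t from below. *)
Lemma sublinear_growth (C theta : R) : 0 < C -> 2^-1 < theta ->
  (forall k, (K <= k)%N ->
     r (k + N)%N `^ (2 * theta) <= C * (r k - r (k + N)%N)) ->
  exists2 mu, 0 < mu & forall k, (K <= k)%N -> 0 < r (k + N)%N ->
    r k `^ (1 - 2 * theta) + mu <= r (k + N)%N `^ (1 - 2 * theta).
Proof.
move=> C0 th12 rec; pose s := 2 * theta - 1.
have s0 : 0 < s by rewrite /s; lra.
have sN : 1 - 2 * theta = - s by rewrite /s; lra.
have pow_neg u : 0 < u -> 1 + s * (1 - u) <= u `^ (- s).
  move=> u0; rewrite /powR gt_eqF//; apply: le_trans (expR_ge1Dx _).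
  have : ln u <= u - 1 by rewrite -{1}[u](subrKC 1) le_ln1Dx; lra.
  rewrite -(ler_pM2l s0); lra.
exists (Num.min (s / (C * 2 `^ (2 * theta))) (s / 2)).
  by rewrite lt_min !divr_gt0// mulr_gt0// powR_gt0.
move=> k Kk rp; rewrite sN; set x := r k; set y := r (k + N)%N.
have yx : y <= x by rewrite noninc// leq_addr.
have x0 : 0 < x by exact: lt_le_trans yx.
have x1 : x <= 1 by exact: r_le1.
have xs1 : 1 <= x `^ (- s).
  by rewrite -(powRr0 x) ger_powR ?x0//; lra.
pose u := y / x; have u0 : 0 < u by rewrite divr_gt0.
have yE : y = u * x by rewrite /u divfK// gt_eqF.
have -> : y `^ (- s) = u `^ (- s) * x `^ (- s) by rewrite yE powRM ?(ltW u0) ?(ltW x0).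
have hu := pow_neg u u0.
have x_s0 : 0 < x `^ (- s) by exact: powR_gt0.
have hux : (1 + s * (1 - u)) * x `^ (- s) <= u `^ (- s) * x `^ (- s).
  by rewrite ler_pM2r.
apply: le_trans hux.
suff : Num.min (s / (C * 2 `^ (2 * theta))) (s / 2) <=
  s * (1 - u) * x `^ (- s) by lra.
have [u2|u2] := leP u 2^-1.
  apply: (@le_trans _ _ (s / 2)); first by rewrite ge_min lexx orbT.
  apply: (@le_trans _ _ (s * (1 - u))); first by rewrite ler_pM2l//; lra.
  by rewrite ler_peMr// mulr_ge0 ?(ltW s0)//; lra.
apply: (@le_trans _ _ (s / (C * 2 `^ (2 * theta)))); first by rewrite ge_min lexx.
have th2 : 0 < 2 `^ (2 * theta) :> R by exact: powR_gt0.
rewrite -mulrA ler_pM2l//.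
(* x - y >= y ^ (2 theta) / C >= x ^ (2 theta) / (2 ^ (2 theta) C) *)
have hx : x `^ (2 * theta) <= C * 2 `^ (2 * theta) * (x - y).
  have : x `^ (2 * theta) <= (2 * y) `^ (2 * theta).
    apply: ge0_ler_powR; rewrite ?nnegrE ?mulr_ge0 ?r0 ?(ltW x0)//; first lra.
    by move: u2; rewrite ltr_pdivlMr//; lra.
  move=> /le_trans; apply; rewrite powRM ?r0// mulrAC mulrC ler_pM2r//.
  exact: rec.
have xE : x `^ (2 * theta) = x * x `^ s.
  by rewrite (_ : 2 * theta = 1 + s) ?powRD ?powRr1 ?(ltW x0)// ?gt_eqF// ?implybT// /s; lra.
have xs0 : 0 < x `^ s by exact: powR_gt0.
rewrite -[leLHS]mul1r ler_pdivrMr ?mulr_gt0// powRN mulrAC.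
rewrite ler_pdivlMr// mul1r.
have : x * ((C * 2 `^ (2 * theta)) * (1 - u)) = C * 2 `^ (2 * theta) * (x - y).
  by rewrite yE; ring.
move: hx; rewrite xE => hx hE; rewrite -hE ler_pM2l// in hx.
by rewrite mulrC.
Qed.

(** Summing the growth of the negative powers along the windows. *)
Lemma sublinear_decay (C theta : R) : 0 < C -> 2^-1 < theta -> theta < 1 ->
  (forall k, (K <= k)%N ->
     r (k + N)%N `^ (2 * theta) <= C * (r k - r (k + N)%N)) ->
  exists2 B, 0 < B & exists K', forall k, (K' <= k)%N ->
    r k `^ (1 - theta) <= B * k%:R `^ ((1 - theta) / (1 - 2 * theta)).
Proof.
move=> C0 th12 th1 rec; have [mu mu0 growth] := sublinear_growth C0 th12 rec.
have th0 : 1 - theta != 0 by rewrite subr_eq0 gt_eqF.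
have th20 : 1 - 2 * theta != 0 by rewrite subr_eq0 lt_eqF//; lra.
have sum j : 0 < r (K + j * N)%N -> mu * j%:R <= r (K + j * N)%N `^ (1 - 2 * theta).
  elim: j => [|j IH] rj; first by rewrite mulr0 powR_ge0.
  have KjN : (K + j.+1 * N = K + j * N + N)%N by rewrite mulSnr addnA.
  rewrite KjN in rj *.
  have rj' : 0 < r (K + j * N)%N by apply: lt_le_trans rj _; rewrite noninc// leq_addr.
  have := growth _ (leq_addr _ _) rj; have := IH rj'.
  by rewrite -natr1; lra.
have N0R : (0 : R) < N%:R by rewrite ltr0n.
pose nu := mu / (2 * N%:R).
have nu0 : 0 < nu by rewrite divr_gt0// mulr_gt0.
exists (nu `^ ((1 - theta) / (1 - 2 * theta))); first exact: powR_gt0.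
exists (2 * (K + N))%N => k kK.
have [->|rk0] := eqVneq (r k) 0.
  by rewrite powR0// mulr_ge0// powR_ge0.
have rk : 0 < r k by rewrite lt_def rk0 r0.
pose j := ((k - K) %/ N)%N.
have Kk : (K <= k)%N.
  by rewrite (leq_trans _ kK)// mul2n -addnn -addnA leq_addr.
have jk : (K + j * N <= k)%N.
  by rewrite -leq_subRL// leq_trunc_div.
have kj : (k <= 2 * N * j)%N.
  have lt_k : (k <= j * N + (K + N))%N.
    have := ltn_ceil (k - K) N0; rewrite -/j mulSn => /ltnW.
    by rewrite leq_subLR [(j * N + _)%N]addnC -addnA.
  rewrite -(leq_add2r k) addnn -mul2n.
  apply: (@leq_trans (2 * (j * N + (K + N)))); first by rewrite leq_mul2l.
  by rewrite mulnDr -mulnA [(N * j)%N]mulnC leq_add.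
have rj : 0 < r (K + j * N)%N by apply: lt_le_trans rk _; exact: noninc.
have k0 : (0 : R) <= k%:R by [].
have uk : nu * k%:R <= r k `^ (1 - 2 * theta).
  have -> : r k `^ (1 - 2 * theta) = (r k `^ (2 * theta - 1))^-1.
    by rewrite -powRN opprB.
  have rjk : r k `^ (2 * theta - 1) <= r (K + j * N)%N `^ (2 * theta - 1).
    by apply: ge0_ler_powR; rewrite ?nnegrE ?r0//; [lra|exact: noninc].
  have := sum _ rj; rewrite -[1 - 2 * theta]opprB powRN => /le_trans h.
  apply: (@le_trans _ _ (mu * j%:R)).
    rewrite /nu -mulrA ler_pM2l// mulrC ler_pdivrMr ?mulr_gt0//.
    by rewrite -!natrM ler_nat [(j * _)%N]mulnC.
  by apply: h; rewrite lef_pV2// posrE powR_gt0.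
have kp : (0 : R) < k%:R by rewrite ltr0n (leq_trans _ kK)// muln_gt0 addn_gt0 N0 orbT.
have -> : r k `^ (1 - theta) =
    (r k `^ (1 - 2 * theta)) `^ ((1 - theta) / (1 - 2 * theta)).
  by rewrite -powRrM mulrC divfK.
rewrite -powRM ?(ltW nu0)//.
have -> : (1 - theta) / (1 - 2 * theta) = - ((1 - theta) / (2 * theta - 1)).
  by field; rewrite th20 -opprB oppr_eq0 th20.
rewrite !powRN lef_pV2 ?posrE ?powR_gt0 ?(mulr_gt0 nu0 kp)//.
apply: ge0_ler_powR; rewrite ?nnegrE ?powR_ge0//.
  by apply: divr_ge0; lra.
by apply: mulr_ge0 => //; exact: ltW.
Qed.

End Rates.

(** For theta <= 1/2 the recursion gives r (k + N) <= C * (r k - r (k + N)), hence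
    geometric decay of r, and the square root of r is the larger of the two terms.
    For theta > 1/2 it is r ^ (1 - theta), for which the growth of the negative
    powers of r gives the rate. *)
Lemma KL_tail_rate (R : realType) (r : nat -> R) (N K1 : nat)
    (A b c eta theta : R) (phi psi : R -> R) :
  (0 < N)%N -> (forall k, 0 <= r k) -> (forall i j, (i <= j)%N -> r j <= r i) ->
  r K1 <= 1 -> r K1 < eta -> 0 <= A -> 0 <= b -> 0 < c -> 0 < theta < 1 ->
  gauge eta phi psi -> (forall t, phi t = c * t `^ (1 - theta)) ->
  (forall k, (K1 <= k)%N -> 0 < r (k + N)%N ->
     1 <= psi (r (k + N)%N) * (b * Num.sqrt (r k - r (k + N)%N))) ->
  exists C q, [/\ 0 < C, 0 < q < 1 & exists K2, forall k, (K2 <= k)%N ->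
    A * (2 * Num.sqrt (r k) + b * phi (r k)) <=
      if theta <= 2^-1 then C * q ^+ k
      else C * k%:R `^ ((1 - theta) / (1 - 2 * theta))].
Proof.
move=> N0 r0 noninc rK1 rKe A0 b0 c0 th gau phiE kl.
have rec := KL_power_recursion r0 noninc gau b0 c0 th (fun t _ => phiE t) rKe kl.
have /andP[th0 th1] := th.
have le1 k : (K1 <= k)%N -> r k <= 1 by move=> /noninc/le_trans; apply.
pose C1 := (c * b) ^+ 2 + 1.
have C10 : 0 < C1 by rewrite ltr_wpDl// sqr_ge0.
have {}rec k : (K1 <= k)%N ->
    r (k + N)%N `^ (2 * theta) <= C1 * (r k - r (k + N)%N).
  move=> /rec/le_trans; apply; rewrite ler_wpM2r ?lerDl//.
  by rewrite subr_ge0 noninc// leq_addr.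
have bc0 : 0 <= b * c by rewrite mulr_ge0// ltW.
have A2 : 0 <= A * (2 + b * c) by rewrite mulr_ge0// addr_ge0.
have pow_le (t p q : R) : 0 <= t -> t <= 1 -> 0 < q -> q <= p -> t `^ p <= t `^ q.
  move=> t0 t1 q0 qp; have [->|tn0] := eqVneq t 0.
    by rewrite !powR0// gt_eqF// (lt_le_trans q0).
  by apply: ger_powR => //; rewrite lt_def tn0 t0.
have [th12|th12] := leP theta 2^-1.
  have lin k : (K1 <= k)%N -> r (k + N)%N <= C1 * (r k - r (k + N)%N).
    move=> K1k; apply: le_trans (rec k K1k); rewrite -[leLHS]powRr1//.
    apply: pow_le; rewrite ?mulr_gt0//; last by lra.
    by rewrite le1// (leq_trans K1k)// leq_addr.
  have [B [q [B0 q01 Bq]]] := linear_decay N0 r0 noninc C10 lin.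
  have q0 : 0 <= q by move: q01 => /andP[/ltW].
  exists (A * (2 + b * c) * Num.sqrt B + 1), q; split=> //.
    by rewrite ltr_wpDl// mulr_ge0// sqrtr_ge0.
  exists K1 => k K1k.
  have sq : Num.sqrt (r k) <= Num.sqrt B * q ^+ k.
    rewrite -[q ^+ k]ger0_norm ?exprn_ge0// -sqrtr_sqr -sqrtrM ?(ltW B0)//.
    by rewrite ler_wsqrtr// Bq.
  have pw : r k `^ (1 - theta) <= Num.sqrt (r k).
    by rewrite -powR12_sqrt//; apply: pow_le => //; [exact: le1|lra].
  rewrite phiE; apply: (@le_trans _ _ (A * ((2 + b * c) * Num.sqrt (r k)))).
    by rewrite ler_wpM2l//; have := ler_wpM2l bc0 pw; lra.
  rewrite mulrA; apply: (@le_trans _ _ (A * (2 + b * c) * (Num.sqrt B * q ^+ k))).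
    by rewrite ler_wpM2l.
  by rewrite mulrDl mul1r mulrA lerDl exprn_ge0.
have [B B0 [K2 Bk]] := sublinear_decay N0 r0 noninc rK1 C10 th12 th1 rec.
exists (A * (2 + b * c) * B + 1), 2^-1; split.
- by rewrite ltr_wpDl// mulr_ge0// ltW.
- by apply/andP; split; lra.
exists (maxn K1 K2) => k; rewrite geq_max => /andP[K1k K2k].
have pw : Num.sqrt (r k) <= r k `^ (1 - theta).
  by rewrite -powR12_sqrt//; apply: pow_le => //; [exact: le1|lra|lra].
rewrite phiE; apply: (@le_trans _ _ (A * ((2 + b * c) * r k `^ (1 - theta)))).
  by rewrite ler_wpM2l//; lra.
rewrite mulrA; set e := (1 - theta) / (1 - 2 * theta).
apply: (@le_trans _ _ (A * (2 + b * c) * (B * k%:R `^ e))).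
  by rewrite ler_wpM2l// Bk.
by rewrite mulrDl mul1r mulrA lerDl powR_ge0.
Qed.

(** * Uniform Kurdyka-Lojasiewicz inequality along a sequence *)

(** The tangent inequality of a concave function is the limit of the chord
    inequalities on segments that shrink to the point of tangency. *)
Lemma desingularizing_gauge (R : realType) (eta : \bar R) (eta' : R)
    (phi : R -> R) : (eta'%:E <= eta)%E -> desingularizing eta phi ->
  gauge eta' phi (derive1 phi).
Proof.
move=> le_eta [phi_ge0 _ _ conc der].
have lt_eta t : t < eta' -> (t%:E < eta)%E.
  by move=> te; apply: lt_le_trans le_eta; rewrite lte_fin.
split.
- by move=> t /andP[t0 /lt_eta te]; exact: phi_ge0.
- by move=> t /andP[t0 /lt_eta te]; have [] := der t t0 te.
move=> s t /andP[s0 /lt_eta se] /andP[t0 /lt_eta te].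
have [dphi _ _] := der t t0 te; pose d := s - t.
have diff_phi : differentiable phi t by exact/derivable1_diffP.
have dE : 'D_d phi t = derive1 phi t * d.
  rewrite derive1E !deriveE// -[d in LHS]mulr1 -[d * 1]/(d *: (1 : R^o)).
  by rewrite linearZ /= mulrC.
have dd : derivable phi t d by exact: diff_derivable.
have cd : (fun h : R => h^-1 *: ((phi \o shift t) (h *: d) - phi t)) @ 0^'+
    --> derive1 phi t * d.
  rewrite -dE; apply: cvg_trans dd; apply: cvg_app.
  move=> A [e egt0 Ae]; exists e => // x xe xgt0; apply: Ae => //.
  exact/lt0r_neq0.
rewrite -lerBlDl; apply: (cvgr_to_ge cd); near=> l.
have l0 : 0 < l by [].
have l1 : l <= 1 by near: l; exact: nbhs_right_le.
have := convex_functionW conc (t := l) (x := s) (y := t).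
rewrite ltW// l1 => /(_ isT (conj s0 se) (conj (ltW t0) te)).
have -> : l *: (s : R^o) + (1 - l) *: (t : R^o) = l *: d + t.
  by rewrite /d /GRing.scale /=; ring.
move=> h; rewrite /shift /= -[_^-1 *: _]/(_^-1 * _) ler_pdivlMl//; lra.
Unshelve. all: by end_near. Qed.

Section UniformKL.
Context {R : realType} {E : normedModType R} (ip : E -> E -> R).
Variables (p : E -> \bar R).

Lemma regular_limiting_subdiff (u v : E) :
  regular_subdiff ip p u v -> limiting_subdiff ip p u v.
Proof.
move=> ruv; split; first by case: ruv.
by exists (fun=> u), (fun=> v); split => //; exact: cvg_cst.
Qed.

Lemma KL_inequality_real (u u0 v : E) (ps : R) (eta : \bar R) U phi :
  p u0 = ps%:E -> desingularizing eta phi -> KL_inequality ip p u0 eta U phi ->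
  U u -> limiting_subdiff ip p u v ->
  (ps%:E < p u)%E -> (p u < ps%:E + eta)%E ->
  1 <= derive1 phi (fine (p u) - ps) * ipnorm ip v.
Proof.
move=> pu0 [_ _ _ _ der] KL Uu luv lt1 lt2.
have [pu_fin _] := luv; have puE : p u = (fine (p u))%:E by rewrite fineK.
have := KL u Uu; rewrite pu0 => /(_ lt1 lt2); rewrite puE /=.
set w := fine (p u) - ps => KLu.
have w0 : 0 < w by rewrite subr_gt0 -lte_fin -puE.
have we : (w%:E < eta)%E by rewrite EFinB lteBlDl// -puE.
have [_ _ dpos] := der w w0 we.
rewrite -lee_fin EFinM; apply: (le_trans KLu).
rewrite lee_wpmul2l ?lee_fin ?(ltW dpos)//; apply: ereal_inf_lbound.
by exists v.
Qed.

(** The cluster points of a sequence in a compact set need finitely many of the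
    local inequalities, and the sum of the corresponding gauges serves all of
    them at once: increasing psi only weakens the inequality.  Points of the
    compact set that are no cluster points are irrelevant for large indices.
    The predicate Q records the form of phi. *)
Lemma uniform_KL (Q : (R -> R) -> Prop) (K : set E) (z : nat -> E) (ps : R) :
  (forall phi1 phi2, Q phi1 -> Q phi2 -> Q (fun t => phi1 t + phi2 t)) ->
  compact K -> (forall n, K (z n)) ->
  (forall u, cluster (z @ \oo) u -> p u = ps%:E /\
     exists (eta : \bar R) U phi, [/\ (0 < eta)%E, nbhs u U,
       desingularizing eta phi, Q phi & KL_inequality ip p u eta U phi]) ->
  exists eta phi psi, [/\ 0 < eta, gauge eta phi psi, Q phi &
    \forall n \near \oo, forall v, limiting_subdiff ip p (z n) v ->
      ps < fine (p (z n)) < ps + eta ->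
      1 <= psi (fine (p (z n)) - ps) * ipnorm ip v].
Proof.
move=> QD cK Kz KL.
pose good A := exists eta phi psi, [/\ 0 < eta, gauge eta phi psi, Q phi &
    \forall n \near \oo, A (z n) -> forall v, limiting_subdiff ip p (z n) v ->
      ps < fine (p (z n)) < ps + eta ->
      1 <= psi (fine (p (z n)) - ps) * ipnorm ip v].
suff [eta [phi [psi [eta0 gau Qphi near_KL]]]] : good K.
  exists eta, phi, psi; split => //.
  by apply: filterS near_KL => n; apply; exact: Kz.
have goodS A B : A `<=` B -> good B -> good A.
  move=> AB [eta [phi [psi [eta0 gau Qphi near_KL]]]].
  exists eta, phi, psi; split => //.
  by apply: filterS near_KL => n + /AB.
have good_cluster u : cluster (z @ \oo) u -> exists2 U, nbhs u U & good U.
  move=> /KL[pu [eta [U [phi [eta0 uU des Qphi KLu]]]]]; exists U => //.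
  have [eta' eta'0 le_eta] : exists2 eta' : R, 0 < eta' & (eta'%:E <= eta)%E.
    by move: eta0; case: (eta) => [e| |]// e0;
      [exists e|exists 1; rewrite ?ltr01 ?leey].
  exists eta', phi, (derive1 phi); split => //.
    exact: desingularizing_gauge des.
  apply: nearW => n Uz v lv /andP[lt1 lt2].
  have [fin_p _] := lv.
  apply: (KL_inequality_real pu des KLu Uz lv).
    by rewrite -[p _]fineK// lte_fin.
  rewrite -[p _]fineK//; apply: (@lt_le_trans _ _ (ps + eta')%:E).
    by rewrite lte_fin.
  by rewrite EFinD leeD2l.
have [u0 [_ clu0]] : K `&` cluster (z @ \oo) !=set0.
  by apply: cK; exists 0%N => // n _; exact: Kz.
have good0 : good set0.
  by have [U _] := good_cluster _ clu0; exact: goodS.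
apply: (compact_induction cK good0 goodS).
  move=> A B [eta1 [phi1 [psi1 [e1 g1 Q1 n1]]]] [eta2 [phi2 [psi2 [e2 g2 Q2 n2]]]].
  exists (Num.min eta1 eta2), (fun t => phi1 t + phi2 t), (fun t => psi1 t + psi2 t).
  split; [by rewrite lt_min e1|exact: gaugeD|exact: QD|].
  have [_ q1 _] := g1; have [_ q2 _] := g2.
  apply: filterS2 n1 n2 => n h1 h2 AB v lv.
  rewrite -ltrBlDl lt_min => /and3P[ltp lt1 lt2].
  set w := fine _ - ps in lt1 lt2 *.
  have w0 : 0 < w by rewrite subr_gt0.
  have p1 : 0 < psi1 w by rewrite q1// w0.
  have p2 : 0 < psi2 w by rewrite q2// w0.
  have v0 : 0 <= ipnorm ip v := sqrtr_ge0 _.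
  have m1 := mulr_ge0 (ltW p1) v0; have m2 := mulr_ge0 (ltW p2) v0.
  rewrite mulrDl; case: AB => [/h1|/h2] /(_ v lv);
    rewrite ltp -ltrBlDl ?lt1 ?lt2 => /(_ isT); rewrite -/w; lra.
move=> u Ku; have [/good_cluster//|] := pselect (cluster (z @ \oo) u).
move=> /existsNP[A /existsNP[B /not_implyP[FA /not_implyP[uB AB]]]].
exists B => //; move: good0 => [eta [phi [psi [eta0 gau Qphi _]]]].
exists eta, phi, psi; split => //.
have {}FA : \forall n \near \oo, A (z n) by exact: FA.
by apply: filterS FA => n Az Bz; exfalso; apply: AB; exists (z n).
Qed.

End UniformKL.

(** * The smooth part and the sublevel sets *)

Section SmoothPart.
Context {R : realType} {X : normedModType R} (ip : {dot X for (@idfun R)}).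
Hypothesis normE : forall x : X, `|x| = Num.sqrt (ip x x).
Variables (f : X -> \bar R) (O : set X) (grad : X -> X).
Hypotheses (open_O : open O) (C1_f : C1_gradient ip O f grad).

Local Notation fr u := (fine (f u)).

Lemma C1_fineK x : O x -> f x = (fr x)%:E.
Proof. by move=> Ox; have [ffin _ _] := C1_f.1 x Ox; rewrite fineK. Qed.

Lemma C1_continuous x : O x -> {for x, continuous (fun u => fr u)}.
Proof.
move=> Ox; have [_ df _] := C1_f.1 x Ox.
exact: (differentiable_continuous df).
Qed.

Lemma C1_regular x eps : O x -> 0 < eps ->
  \forall y \near x, fr x + (ip (grad x) (y - x) - eps * `|y - x|) <= fr y.
Proof.
move=> Ox e0; have [_ df dE] := C1_f.1 x Ox.
have /eqaddoP/(_ _ e0) h := diff_locally df.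
have c : (fun y => y - x) @ x --> (0 : X).
  by rewrite -(subrr x); apply: cvgB; [exact: cvg_id|exact: cvg_cst].
have {}h : \forall y \near x,
    `|fr (y - x + x) - (fr x + 'd (fine \o f : X -> R^o) x (y - x))| <=
    eps * `|y - x| by exact: c _ h.
by apply: filterS h => y; rewrite dE subrK ler_norml; lra.
Qed.

Lemma C1_line x d t : O (x + t *: d) ->
  is_derive t 1 (fun s : R => fr (x + s *: d)) (ip (grad (x + t *: d)) d).
Proof.
move=> Ot; have [_ df dE] := C1_f.1 _ Ot.
have quot : (fun h : R => h^-1 *: (((fun s : R => fr (x + s *: d)) \o shift t)
      (h *: (1 : R)) - fr (x + t *: d))) =
    (fun h : R => h^-1 *: (((fine \o f : X -> R^o) \o shift (x + t *: d)) (h *: d) -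
      fr (x + t *: d))).
  apply/funext => h; rewrite /shift /= addrCA -scalerDl.
  by rewrite [h *: 1]mulr1.
apply: DeriveDef.
  by rewrite /derivable quot; exact: diff_derivable.
by rewrite /derive quot -dE -deriveE.
Qed.

(** Lipschitz continuity is uniform on a neighbourhood of a compact set, and
    the mean value theorem on the segment gives the descent inequality there. *)
Lemma uniform_descent (K : set X) : locally_lipschitz O grad -> compact K ->
  K `<=` O -> exists r L : R, [/\ 0 < r, 0 <= L & forall x y, K x -> `|y - x| < r ->
    [/\ O y, `|grad y - grad x| <= L * `|y - x| &
        fr y <= fr x + ip (grad x) (y - x) + L * `|y - x| ^+ 2]].
Proof.
move=> lipg cK KO.
pose good A := exists r L : R, [/\ 0 < r, 0 <= L & forall x y, A x ->
    `|y - x| < r -> O y /\ `|grad y - grad x| <= L * `|y - x|].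
have [r [L [r0 L0 rL]]] : good K.
  apply: (compact_induction cK).
  - by exists 1, 0.
  - move=> A B AB [r [L [r0 L0 rL]]]; exists r, L; split => // x y /AB; exact: rL.
  - move=> A B [r1 [L1 [r10 L10 rL1]]] [r2 [L2 [r20 L20 rL2]]].
    exists (Num.min r1 r2), (Num.max L1 L2); split.
    + by rewrite lt_min r10.
    + by rewrite le_max L10.
    + move=> x y AB; rewrite lt_min => /andP[y1 y2].
      case: AB => [/rL1/(_ y1)|/rL2/(_ y2)] [Oy le]; split => //.
        by apply: (le_trans le); rewrite ler_wpM2r// le_max lexx.
      by apply: (le_trans le); rewrite ler_wpM2r// le_max lexx orbT.
  move=> x Kx; have [U xU] := lipg x (KO x Kx).
  move=> [M [Mreal lipU]].
  have [r /= r0 rP] : nbhs_ball x (O `&` U).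
    apply/nbhs_ballP; apply: filterI => //; exact: open_nbhs_nbhs (conj open_O (KO x Kx)).
  exists (ball x (r / 2)); first by apply: nbhsx_ballx; rewrite divr_gt0.
  pose L := Num.max 0 (M + 1).
  exists (r / 2), L; split; [by rewrite divr_gt0|by rewrite le_max lexx|].
  move=> u v; rewrite -ball_normE /= => xu uv.
  have xv : ball x r v.
    rewrite -ball_normE /= -(subrKA u) (le_lt_trans (ler_normD _ _))//.
    by move: xu uv; rewrite [`|v - u|]distrC; lra.
  have xu' : ball x r u by rewrite -ball_normE /=; move: xu; lra.
  have [Ov Uv] := rP _ xv; have [Ou Uu] := rP _ xu'; split => //.
  have ML : M < L by rewrite lt_max ltrDl ltr01 orbT.
  exact: (lipU L ML (v, u)).
exists r, L; split => // x y Kx yr; have [Oy lipy] := rL x y Kx yr; split => //.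
pose d := y - x.
have seg (t : R) : 0 <= t <= 1 -> `|x + t *: d - x| < r.
  move=> /andP[t0 t1]; rewrite [x + _]addrC addrK normrZ ger0_norm//.
  by apply: le_lt_trans yr; rewrite ler_piMl.
have segO (t : R) : 0 <= t <= 1 -> O (x + t *: d).
  by move=> /seg /(rL x _ Kx)[].
pose psi (t : R) := fr (x + t *: d).
have dpsi (t : R) : 0 <= t <= 1 -> is_derive t 1 psi (ip (grad (x + t *: d)) d).
  by move=> /segO; exact: C1_line.
have [||t] := @MVT R psi (fun t => ip (grad (x + t *: d)) d) 0 1 ltr01.
- by move=> t; rewrite in_itv /= => /andP[/ltW t0 /ltW t1]; apply: dpsi; rewrite t0.
- apply: derivable_within_continuous => t; rewrite in_itv /= => t01.
  by have [] := dpsi t t01.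
rewrite in_itv /= => /andP[/ltW t0 /ltW t1].
rewrite /psi scale1r scale0r addr0 subr0 mulr1 {1}/d subrKC => mvt.
have [_ lipt] := rL x _ Kx (seg t ltac:(by rewrite t0)).
have : ip (grad (x + t *: d) - grad x) d <= L * `|d| ^+ 2.
  apply: (le_trans (ip_le normE _ _)); rewrite expr2 mulrA ler_wpM2r//.
  apply: (le_trans lipt); rewrite ler_wpM2l// addrC addKr normrZ ger0_norm//.
  by rewrite ler_piMl.
by rewrite (ipDl, ipNl) ipNl; move: mvt; rewrite -/d; lra.
Qed.

End SmoothPart.

Lemma sublevel_closed (R : realType) (X : normedModType R) (f g : X -> \bar R)
    (h : X -> R) (c : R) :
  lower_semicontinuous f -> lower_semicontinuous g -> continuous h ->
  (forall x, f x != -oo%E) -> (forall x, g x != -oo%E) ->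
  closed [set x | (objective f g h x <= c%:E)%E].
Proof.
move=> lf lg ch fy gy; rewrite -[X in closed X]setCK; apply: open_closedC.
rewrite openE => x /= /negP; rewrite -ltNge /objective => Fx.
have [a [b [af bg abc]]] : exists a b, [/\ (a%:E < f x)%E, (b%:E < g x)%E &
    c + h x < a + b].
  move: Fx (fy x) (gy x); case: (f x) => [u| |]//; case: (g x) => [v| |]//.
  - rewrite -[(_ - _)%E]/((u + v - h x)%:E) lte_fin => lt _ _.
    pose e := (u + v - h x - c) / 3; exists (u - e), (v - e).
    by rewrite !lte_fin; split; rewrite /e; lra.
  - move=> _ _ _; exists (u - 1), (c + h x - u + 2).
    by rewrite lte_fin ltry; split=> //; lra.
  - move=> _ _ _; exists (c + h x - v + 2), (v - 1).
    by rewrite lte_fin ltry; split=> //; lra.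
  - by move=> _ _ _; exists (c + h x + 1), 0; rewrite !ltry; split=> //; lra.
have [U xU fU] := lf x a af; have [V xV gV] := lg x b bg.
have hc : \forall y \near x, h y < a + b - c by apply: (cvgr_lt (h x)); [exact: ch|lra].
near=> y; apply/negP; rewrite -ltNge.
have Uy : U y by near: y. 
have Vy : V y by near: y.
have hy : h y < a + b - c by near: y.
apply: (@lt_le_trans _ _ (a%:E + b%:E - (h y)%:E)%E).
  by rewrite -[(_ - _)%E]/((a + b - h y)%:E) lte_fin; lra.
by rewrite leeB// leeD// ltW//; [exact: fU|exact: gV].
Unshelve. all: by end_near. Qed.

(** * One step of the method *)

Section ProximalStep.
Context {R : realType} {X : normedModType R} (ip : {dot X for (@idfun R)}).
Hypothesis normE : forall x : X, `|x| = Num.sqrt (ip x x).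
Variables (f g : X -> \bar R) (h : X -> R) (O : set X) (grad : X -> X).
Hypotheses (open_O : open O) (C1_f : C1_gradient ip O f grad)
  (gNy : forall x, g x != -oo%E).
Variables (xk y xi : X) (gam : R).
Hypotheses (Oxk : O xk) (gxk : g xk \is a fin_num) (gam0 : 0 < gam)
  (sub : subgradient ip h xk (- xi))
  (opt : minimizer (subproblem ip f g grad xk xi gam) y).

Local Notation fr u := (fine (f u)).
Local Notation gr u := (fine (g u)).
Let model u := ip (grad xk + xi) (u - xk) + gam / 2 * `|u - xk| ^+ 2.

Let prox_min u : ((model y)%:E + g y <= (model u)%:E + g u)%E.
Proof.
have := opt u; rewrite /subproblem (C1_fineK C1_f Oxk) -!addeA.
by rewrite leeD2lE.
Qed.

Lemma prox_fin_num : g y \is a fin_num.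
Proof.
have := prox_min xk; rewrite -[g xk]fineK// -EFinD.
by move: (gNy y); case: (g y).
Qed.

Lemma prox_ge u : ((gr y + model y - model u)%:E <= g u)%E.
Proof.
have := prox_min u; rewrite -[g y]fineK ?prox_fin_num//.
move: (gNy u); case: (g u) => [v| |]// _; last by move=> _; exact: leey.
by rewrite -!EFinD !lee_fin; lra.
Qed.

Lemma prox_value : gr y + model y <= gr xk.
Proof.
have := prox_ge xk; rewrite -[g xk]fineK// lee_fin /model subrr.
by rewrite linear0r normr0 expr0n /= mulr0 addr0 subr0.
Qed.

Let model_sub u : model u - model y =
  ip (grad xk + xi + gam *: (y - xk)) (u - y) + gam / 2 * `|u - y| ^+ 2.
Proof.
have uE : u - xk = (y - xk) + (u - y) by rewrite [RHS]addrC subrKA.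
by rewrite /model uE (norm_sqrD normE) !ipE; field.
Qed.

(** The optimality condition of the subproblem, up to the curvature of its
    quadratic term. *)
Lemma prox_regular :
  regular_subdiff ip g y (- (grad xk + xi) - gam *: (y - xk)).
Proof.
split; first exact: prox_fin_num.
move=> eps e0; have d0 : 0 < eps / gam by rewrite divr_gt0.
near=> u.
have uy : `|u - y| <= eps / gam.
  by rewrite distrC; near: u; apply: cvgr_dist_le => //; exact: cvg_id.
apply: le_trans (prox_ge u); rewrite -[g y]fineK ?prox_fin_num// -EFinD lee_fin.
rewrite -addrA lerD2l /ipnorm -normE.
have := model_sub u; rewrite -opprD ipNl.
have : gam / 2 * `|u - y| ^+ 2 <= eps * `|u - y|.
  rewrite expr2 mulrA ler_wpM2r// mulrAC ler_pdivrMr//.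
  by move: uy; rewrite ler_pdivlMr//; lra.
lra.
Unshelve. all: by end_near. Qed.

Hypothesis Oy : O y.

(** The conjugate is exact at the subgradient, h^*(- xi) = - <xi, xk> - h xk. *)
Lemma merit_step :
  merit ip f g h (y, xi) = (fr y + gr y + ip xi (y - xk) - h xk)%:E.
Proof.
rewrite /merit /= (conjugate_subgradient sub) (C1_fineK C1_f Oy).
rewrite -[g y]fineK ?prox_fin_num// -!EFinD; congr EFin.
by rewrite !ipE; ring.
Qed.

(** This is Fenchel's inequality for h at y, as - xi is a subgradient at xk. *)
Lemma objective_le_merit :
  fr y + gr y - h y <= fr y + gr y + ip xi (y - xk) - h xk.
Proof. by have := sub y; rewrite ipNl; lra. Qed.

Lemma merit_le_objective (L : R) :
  fr y <= fr xk + ip (grad xk) (y - xk) + L * `|y - xk| ^+ 2 ->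
  fr y + gr y + ip xi (y - xk) - h xk <=
    fr xk + gr xk - h xk + (L - gam / 2) * `|y - xk| ^+ 2.
Proof.
by move=> desc; have := prox_value; rewrite /model ipDl; lra.
Qed.

(** Each summand of the merit function is bounded below near (y, xi): f by its
    gradient, g by the optimality of y, the coupling by bilinearity and the
    conjugate by the affine function of xk.  All errors are O(|u - z|^2), up to
    the o(|u - z|) of f. *)
Lemma merit_regular : regular_subdiff (prod_ip ip) (merit ip f g h) (y, xi)
  (grad y - grad xk - gam *: (y - xk), y - xk).
Proof.
split; first by rewrite merit_step.
move=> eps e0; have e20 : 0 < eps / 2 by rewrite divr_gt0.
have gam2 : 0 < gam + 2 by rewrite addr_gt0.
pose del := eps / (gam + 2) / 2.
have del0 : 0 < del by rewrite !divr_gt0.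
have c1 : (fun u : X * X => u.1) @ (y, xi) --> y by exact: cvg_fst.
have c2 : (fun u : X * X => u.2) @ (y, xi) --> xi by exact: cvg_snd.
have near_f : \forall u \near (y, xi),
    O u.1 /\ fr y + (ip (grad y) (u.1 - y) - eps / 2 * `|u.1 - y|) <= fr u.1.
  have : \forall v \near y,
      O v /\ fr y + (ip (grad y) (v - y) - eps / 2 * `|v - y|) <= fr v.
    near=> v; split; near: v; last exact: (C1_regular C1_f).
    exact: open_nbhs_nbhs.
  by move=> /c1.
near=> u; rewrite merit_step.
have [Ou fu] : O u.1 /\
    fr y + (ip (grad y) (u.1 - y) - eps / 2 * `|u.1 - y|) <= fr u.1 by near: u.
have e1d : `|u.1 - y| <= del.
  by rewrite distrC; near: u; exact: (cvgr_dist_le _ _ c1).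
have e2d : `|u.2 - xi| <= del.
  by rewrite distrC; near: u; exact: (cvgr_dist_le _ _ c2).
set e1 := u.1 - y in e1d fu *; set e2 := u.2 - xi in e2d *.
set n := ipnorm _ _.
have n0 : 0 <= n by exact: sqrtr_ge0.
have nE : n ^+ 2 = `|e1| ^+ 2 + `|e2| ^+ 2.
  by rewrite /n /ipnorm /prod_ip /= -/e1 -/e2 !(ipxx normE) sqr_sqrtr ?addr_ge0 ?exprn_ge0.
have e1n : `|e1| <= n.
  by rewrite -(@ler_pXn2r _ 2)// ?nnegrE// nE lerDl exprn_ge0.
have e2n : `|e2| <= n.
  by rewrite -(@ler_pXn2r _ 2)// ?nnegrE// nE lerDr exprn_ge0.
have nd : n <= 2 * del.
  have n2d : n <= `|e1| + `|e2|.
    rewrite -(@ler_pXn2r _ 2)// ?nnegrE ?addr_ge0// nE.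
    by have := mulr_ge0 (normr_ge0 e1) (normr_ge0 e2); lra.
  by lra.
have quad : (gam / 2 + 1) * n ^+ 2 <= eps / 2 * n.
  rewrite expr2 mulrA ler_wpM2r//.
  have : (gam + 2) * n <= (gam + 2) * (2 * del) by rewrite ler_pM2l.
  rewrite [X in _ <= X -> _](_ : _ = eps); first lra.
  by rewrite /del; field; rewrite gt_eqF.
rewrite /merit (C1_fineK C1_f Ou).
apply: (@le_trans _ _ ((fr u.1)%:E + (gr y + model y - model u.1)%:E +
   (ip u.2 u.1)%:E + (ip (- u.2) xk - h xk)%:E)%E); last first.
  apply: leeD; last exact: conjugate_ge.
  by apply: leeD => //; apply: leeD => //; exact: prox_ge.
rewrite -!EFinD lee_fin /prod_ip /= -/e1 -/e2 [ip (y - xk) e2]ipC.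
have u1E : u.1 = y + e1 by rewrite subrKC.
have u2E : u.2 = xi + e2 by rewrite subrKC.
have := model_sub u.1; rewrite -/e1; clearbody e1 e2 n.
have := ip_ge normE e2 e1.
have : `|e2| * `|e1| <= n ^+ 2 by rewrite expr2 ler_pM.
have : gam / 2 * `|e1| ^+ 2 <= gam / 2 * n ^+ 2.
  by rewrite ler_wpM2l ?divr_ge0 ?(ltW gam0)// ler_pXn2r ?nnegrE.
have : eps / 2 * `|e1| <= eps / 2 * n by rewrite ler_pM2l.
move: fu quad; rewrite u2E u1E !ipE; lra.
Unshelve. all: by end_near. Qed.

Lemma merit_subgradient_le (L : R) :
  `|grad y - grad xk| <= L * `|y - xk| ->
  ipnorm (prod_ip ip) (grad y - grad xk - gam *: (y - xk), y - xk) <=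
    (L + gam + 1) * `|y - xk|.
Proof.
move=> lip; rewrite /ipnorm /prod_ip /= !(ipxx normE).
set a := `|_ - _ - _|; set d := `|y - xk|.
have ad : a <= (L + gam) * d.
  apply: (le_trans (ler_normB _ _)); rewrite normrZ gtr0_norm// mulrDl.
  by rewrite lerD2r.
have a0 : 0 <= a by exact: normr_ge0.
have d0 : 0 <= d by exact: normr_ge0.
apply: (@le_trans _ _ (a + d)); last by lra.
rewrite -[leRHS]ger0_norm ?addr_ge0// -sqrtr_sqr ler_wsqrtr//.
by have := mulr_ge0 a0 d0; lra.
Qed.

End ProximalStep.

(** * The iterates of the method *)

Lemma le_bigmaxe (R : realType) (u : nat -> \bar R) (i j k : nat) :
  (i <= k < j)%N -> (u k <= \big[maxe/-oo%E]_(i <= l < j) u l)%E.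
Proof. by move=> ikj; apply: le_bigmax_seq => //; rewrite mem_index_iota. Qed.

Lemma bigmaxe_attained (R : realType) (u : nat -> \bar R) (i j : nat) :
  (i < j)%N -> (forall k, u k != -oo%E) ->
  exists k, [/\ (i <= k)%N, (k < j)%N & (\big[maxe/-oo%E]_(i <= l < j) u l = u k)].
Proof.
move=> ij uNy.
have : \big[maxe/-oo%E]_(i <= l < j) u l = -oo%E \/
    exists k, [/\ (i <= k)%N, (k < j)%N & (\big[maxe/-oo%E]_(i <= l < j) u l = u k)].
  rewrite big_seq; elim/big_ind: _ => [|a b|k]; first by left.
  - move=> [->|[k [ik kj ->]]] [->|[l [il lj ->]]].
    + by left; rewrite maxxx.
    + by right; exists l; rewrite maxNye.
    + by right; exists k; rewrite maxeNy.
    + by right; case: (leP (u k) (u l)) => _; [exists l|exists k].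
  - by rewrite mem_index_iota => /andP[ik kj]; right; exists k.
move=> [big_Ny|//]; exfalso; have /eqP := uNy i; apply; apply/eqP.
by rewrite -leeNy_eq -big_Ny; apply: le_bigmaxe; rewrite leqnn.
Qed.

Lemma nneseries_le_bound (R : realType) (D : nat -> R) (k : nat) (B : R) :
  (forall j, 0 <= D j) -> (forall n, \sum_(k <= j < n) D j <= B) ->
  (\sum_(k <= j <oo) (D j)%:E <= B%:E)%E.
Proof.
move=> D0 DB; apply: lime_le.
  by apply: is_cvg_nneseries => j _ _; rewrite lee_fin.
by apply: nearW => n; rewrite sumEFin lee_fin.
Qed.

(** The triangle inequality, passed to the limit along the subsequence. *)
Lemma dist_le_tail (R : realType) (X : normedModType R) (x : nat -> X) (xb : X)
    (t : nat -> nat) (k : nat) :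
  (forall n, (n <= t n)%N) -> (fun n => x (t n)) @ \oo --> xb ->
  (`|x k - xb|%:E <= \sum_(k <= j <oo) `|x j.+1 - x j|%:E)%E.
Proof.
move=> tn xt; set S := (X in (_ <= X)%E).
have partial n : (`|x k - x (k + n)%N|%:E <= S)%E.
  apply: (@le_trans _ _ (\sum_(k <= j < k + n) `|x j.+1 - x j|%:E)%E); last first.
    by apply: nneseries_lim_ge => j _ _; rewrite lee_fin.
  rewrite sumEFin lee_fin distrC; elim: n => [|n IH].
    by rewrite addn0 subrr normr0 big_geq.
  rewrite addnS big_nat_recr ?leq_addr//= addrC -(subrKA (x (k + n)%N)).
  by rewrite (le_trans (ler_normD _ _))// lerD2l.
have S0 : (0 <= S)%E by apply: nneseries_ge0 => j _ _; rewrite lee_fin.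
move: S0 partial; case: S => [s| |]//; last by move=> _ _; exact: leey.
move=> _ partial; rewrite lee_fin.
have c : (fun n => `|x k - x (t n)|) @ \oo --> `|x k - xb|.
  by apply: cvg_norm; apply: cvgB => //; exact: cvg_cst.
apply: (cvgr_to_le c); exists k => // n /= kn.
have := partial (t n - k)%N; rewrite subnKC ?lee_fin//.
exact: leq_trans kn (tn n).
Qed.

Section Method.
Context {R : realType} {X : normedModType R} (ip : {dot X for (@idfun R)}).
Variables (f g : X -> \bar R) (h : X -> R) (O : set X) (grad : X -> X)
  (m : nat) (gmin gmax rho delta alpha c : R) (x : nat -> X).
Hypotheses (euclidX : is_euclidean ip)
  (proper_f : proper_efun f) (lsc_f : lower_semicontinuous f)
  (open_O : open O) (domg_O : edom g `<=` O)
  (C1_f : C1_gradient ip O f grad) (lip_grad : locally_lipschitz O grad)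
  (proper_g : proper_efun g) (lsc_g : lower_semicontinuous g)
  (bnd_g : bounded_below g)
  (convex_h : convex_function (E := X) [set: X] h)
  (bnd_F : bounded_below (objective f g h))
  (gmin_gt0 : 0 < gmin) (gmin_gmax : gmin <= gmax) (rho_gt1 : 1 < rho)
  (delta01 : 0 < delta < 1) (alpha01 : 0 <= alpha <= 1) (c_gt0 : 0 < c)
  (NPG_x : NPG_sequence ip f g h grad m gmin gmax rho delta alpha c x)
  (bnd_L : bounded_set
     [set y : X | (objective f g h y <= objective f g h (x 0%N))%E]).

Local Notation fr u := (fine (f u)).
Local Notation gr u := (fine (g u)).
Local Notation F u := (fr u + gr u - h u).
Local Notation K := [set y : X | (objective f g h y <= objective f g h (x 0%N))%E].
Local Notation accept := (accepted (objective f g h) m delta alpha c x).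

Let normE : forall u : X, `|u| = Num.sqrt (ip u u). Proof. exact: euclidX.1. Qed.

Let fNy u : f u != -oo%E. Proof. exact: proper_f.2. Qed.
Let gNy u : g u != -oo%E. Proof. exact: proper_g.2. Qed.

Let dom_O u : g u \is a fin_num -> O u.
Proof. by move=> gu; apply: domg_O; rewrite /edom /= ltey_eq gu. Qed.

Let objectiveE u : g u \is a fin_num -> objective f g h u = (F u)%:E.
Proof.
by move=> gu; rewrite /objective (C1_fineK C1_f (dom_O gu)) -[g u]fineK.
Qed.

Let gx0 : g (x 0%N) \is a fin_num.
Proof.
have [] := NPG_x; rewrite /edom /= => gx _.
by move: gx (gNy (x 0%N)); case: (g _).
Qed.

Let finite_g u : (objective f g h u < +oo)%E -> g u \is a fin_num.
Proof.
rewrite /objective; move: (fNy u) (gNy u).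
by case: (f u) => [a| |]//; case: (g u) => [b| |].
Qed.

Let K_fin u : K u -> g u \is a fin_num.
Proof.
by move=> /= Ku; apply: finite_g; apply: le_lt_trans Ku _; rewrite objectiveE ?ltry.
Qed.

Let K_O : K `<=` O. Proof. by move=> u /K_fin; exact: dom_O. Qed.

Let K_compact : compact K.
Proof.
apply: (bounded_closed_compact_euclid normE euclidX) => //; rewrite objectiveE//.
apply: sublevel_closed => //; exact: (convex_continuous euclidX convex_h).
Qed.

Let K_F u : K u -> F u <= F (x 0%N).
Proof. by move=> Ku; move: (Ku); rewrite /= !objectiveE ?lee_fin//; exact: K_fin. Qed.

(** The subgradients of h are bounded since h is bounded on a larger ball. *)
Let uniform_bounds : exists B : R, forall u, K u ->
  [/\ `|u| <= B, `|fr u| <= B, `|h u| <= B, `|grad u| <= B &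
      forall xi, limiting_subdiff ip (neg_fun h) u xi -> `|xi| <= B].
Proof.
have loc (u : X -> R) v : u @ v --> u v ->
    exists B, \forall y \near v, `|u y| <= B.
  move=> cu; exists (`|u v| + 1); near=> y.
  have : `|u v - u y| <= 1 by near: y; exact: (cvgr_dist_le _ _ cu).
  by have := ler_normB (u v) (u v - u y); rewrite subKr; lra.
have [B0 bB0] : exists B, forall u, K u -> `| `|u| | <= B.
  by apply: compact_locally_bounded => // v _; apply: loc; exact: norm_continuous.
have [B1 bB1] : exists B, forall u, K u -> `|fr u| <= B.
  apply: compact_locally_bounded => // v Kv; apply: (loc (fun u => fr u)).
  exact: (C1_continuous C1_f (K_O Kv)).
have [B2 bB2] : exists B, forall u, K u -> `| `|grad u| | <= B.
  apply: compact_locally_bounded => // v Kv; apply: (loc (fun u => `|grad u|)).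
  by apply: cvg_norm; exact: C1_f.2 v (K_O Kv).
pose ballK := [set u : X | `|u| <= B0 + 1].
have cball : compact ballK.
  apply: (bounded_closed_compact_euclid normE euclidX).
    exists (B0 + 1); split; first exact: num_real.
    by move=> t Bt u /le_trans; apply; exact: ltW.
  rewrite (_ : ballK = (fun u : X => `|u|) @^-1` [set t | t <= B0 + 1])//.
  by apply: closed_comp => [u _|]; [exact: norm_continuous|exact: closed_le].
have [B3 bB3] : exists B, forall u, ballK u -> `|h u| <= B.
  apply: compact_locally_bounded => // v _; apply: loc.
  exact: (convex_continuous euclidX convex_h).
exists (`|B0| + `|B1| + `|B2| + 2 * `|B3|) => u Ku.
have := ler_norm B0; have := ler_norm B1; have := ler_norm B2.
have := ler_norm B3; have := normr_ge0 B0; have := normr_ge0 B1.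
have := normr_ge0 B2; have := normr_ge0 B3 => p3 p2 p1 p0 q3 q2 q1 q0.
have uB0 : `|u| <= B0 by have := bB0 u Ku; rewrite normr_id.
have hB3 v : `|v| <= B0 + 1 -> `|h v| <= B3.
  exact: bB3.
split; first lra.
- by have := bB1 u Ku; lra.
- by have := hB3 u; lra.
- by have := bB2 u Ku; rewrite normr_id; lra.
- move=> xi /(limiting_neg_subgradient euclidX convex_h) sub.
  by have := subgradient_bound euclidX hB3 uB0 sub; rewrite normrN; lra.
Unshelve. all: by end_near. Qed.

(** A large stepsize parameter forces the trial point to stay close to x k,
    because g is bounded below, and there the quadratic term dominates the
    Lipschitz constant of the gradient: the trial point is accepted. *)
Let large_accepted : exists Gam : R, forall k y xi gam,
  K (x k) -> Gam <= gam -> limiting_subdiff ip (neg_fun h) (x k) xi ->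
  minimizer (subproblem ip f g grad (x k) xi gam) y -> accept k gam y.
Proof.
have [B KB] := uniform_bounds.
have [r [L [r0 L0 desc]]] := uniform_descent normE open_O C1_f lip_grad K_compact K_O.
have [gb gbP] := bnd_g; have /andP[d0 d1] := delta01; have /andP[al0 al1] := alpha01.
pose V := `|F (x 0%N) + B + B - gb|.
have V0 : 0 <= V := normr_ge0 _.
have B0 : 0 <= B.
  have K0 : K (x 0%N) by exact: lexx.
  by have [xB _ _ _ _] := KB _ K0; exact: le_trans (normr_ge0 _) xB.
pose G1 := 2 * (V / r ^+ 2 + (B + B) / r) + 1.
pose G2 := (2 * L + c) / (1 - delta).
exists (Num.max G1 G2) => k y xi gam Kk; rewrite ge_max => /andP[gam1 gam2] lim opt.
have r20 : 0 < r ^+ 2 by rewrite exprn_gt0.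
have G10 : 0 < G1.
  have := divr_ge0 V0 (ltW r20); have := divr_ge0 (addr_ge0 B0 B0) (ltW r0).
  by rewrite /G1; lra.
have gam0 : 0 < gam by exact: lt_le_trans gam1.
have gx := K_fin Kk; have Ox := K_O Kk.
have gy := prox_fin_num C1_f gNy Ox gx opt.
have val := prox_value C1_f gNy Ox gx opt.
have [_ fB hB gB xiB] := KB _ Kk.
set D := `|y - x k| in val *; have D0 : 0 <= D := normr_ge0 _.
have Dr : D < r.
  rewrite ltNge; apply/negP => rD.
  have grx : gr (x k) - gr y <= V.
    have : gb <= gr y by rewrite -lee_fin fineK.
    have := K_F Kk; have := ler_norm (F (x 0%N) + B + B - gb); rewrite -/V.
    by move: fB hB; rewrite !ler_norml; lra.
  have ipB : - ((B + B) * D) <= ip (grad (x k) + xi) (y - x k).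
    apply: le_trans (ip_ge normE _ _); rewrite lerN2 ler_wpM2r//.
    by rewrite (le_trans (ler_normD _ _))// lerD// xiB.
  have VD : V <= V / r ^+ 2 * D ^+ 2.
    rewrite mulrAC ler_pdivlMr// ler_wpM2l// ler_pXn2r ?nnegrE//; exact: ltW.
  have BD : (B + B) * D <= (B + B) / r * D ^+ 2.
    rewrite mulrAC ler_pdivlMr// -mulrA ler_wpM2l ?addr_ge0// expr2.
    by rewrite ler_wpM2l.
  have : gam / 2 * D ^+ 2 <= (V / r ^+ 2 + (B + B) / r) * D ^+ 2 by lra.
  by rewrite ler_pM2r; [move: gam1; rewrite /G1; lra|rewrite exprn_gt0// (lt_le_trans r0)].
have [_ _ fdesc] := desc _ _ Kk Dr.
have Oy := dom_O gy.
have sub := limiting_neg_subgradient euclidX convex_h lim.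
have FyFx := le_trans (objective_le_merit f g y sub)
  (merit_le_objective h C1_f gNy Ox gx opt fdesc).
rewrite /accepted (objectiveE gy).
set Mk := (X in (_ <= X - _)%E).
have xM : ((F (x k))%:E <= Mk)%E.
  rewrite -(objectiveE gx); apply: (@le_bigmaxe _ (fun i => objective f g h (x i))).
  by rewrite leq_subr ltnS leqnn.
rewrite leeBrDr//; apply: le_trans xM; rewrite -EFinD lee_fin -/D.
have h2 : (alpha * delta * gam + (1 - alpha) * c) / 2 <= gam / 2 - L.
  have : (2 * L + c) <= gam * (1 - delta).
    by move: gam2; rewrite /G2 ler_pdivrMr// subr_gt0.
  have : alpha * delta * gam <= delta * gam.
    by rewrite ler_pM2r// ler_piMl// ltW.
  have : 0 <= alpha * c by rewrite mulr_ge0// ltW.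
  lra.
have : (alpha * delta * gam + (1 - alpha) * c) / 2 * D ^+ 2 <= (gam / 2 - L) * D ^+ 2.
  by rewrite ler_wpM2r// exprn_ge0.
by move: FyFx; rewrite -/D; lra.
Qed.

Let accepted_descent k gam y : (forall i, (i <= k)%N -> K (x i)) ->
  g y \is a fin_num -> accept k gam y ->
  exists i, [/\ (k - m <= i)%N, (i <= k)%N &
    F y + (alpha * delta * gam + (1 - alpha) * c) / 2 * `|y - x k| ^+ 2 <= F (x i)].
Proof.
move=> Kx gy; rewrite /accepted (objectiveE gy).
pose u i := if (i <= k)%N then objective f g h (x i) else 0%E.
have -> : \big[maxe/-oo%E]_((k - m)%N <= i < k.+1) objective f g h (x i) =
    \big[maxe/-oo%E]_((k - m)%N <= i < k.+1) u i.
  by apply: eq_big_nat => i /andP[_]; rewrite ltnS /u => ->.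
have uNy i : u i != -oo%E.
  by rewrite /u; case: ifP => // /Kx /K_fin/objectiveE ->.
have [|i [mi]] := @bigmaxe_attained _ u (k - m) k.+1 _ uNy.
  by rewrite ltnS leq_subr.
rewrite ltnS => ik ->; rewrite /u ik (objectiveE (K_fin (Kx i ik))).
by move=> le; exists i; split => //; move: le; rewrite leeBrDr// -EFinD lee_fin.
Qed.

Let coef_ge0 gam : 0 < gam -> 0 <= (alpha * delta * gam + (1 - alpha) * c) / 2.
Proof.
move=> gam0; have /andP[d0 _] := delta01; have /andP[al0 al1] := alpha01.
have := mulr_ge0 (mulr_ge0 al0 (ltW d0)) (ltW gam0).
have : 0 <= (1 - alpha) * c by rewrite mulr_ge0 ?subr_ge0// ltW.
lra.
Qed.

(** What the rest of the proof uses of the method.  A stepsize parameter is the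
    first one or rho times a rejected one, hence bounded; and as it is at least
    gmin, the acceptance test ensures a decrease with a fixed factor a. *)
Lemma NPG_iterates : exists (K : set X) (Gam a B : R) (xi : nat -> X)
    (gam : nat -> R),
  [/\ compact K, (forall u, K u -> g u \is a fin_num /\ F u <= F (x 0%N)),
      (forall k, K (x k)), 0 < a &
      forall k, [/\ gmin <= gam k <= Gam,
        limiting_subdiff ip (neg_fun h) (x k) (xi k), `|xi k| <= B,
        minimizer (subproblem ip f g grad (x k) (xi k) (gam k)) (x k.+1) &
        exists i, [/\ (k - m <= i)%N, (i <= k)%N &
          F (x k.+1) + a * `|x k.+1 - x k| ^+ 2 <= F (x i)]]].
Proof.
have [Gam0 acc] := large_accepted; pose Gam := Num.max gmax (rho * Gam0).
have [_ step] := NPG_x.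
have Kstep k : K (x k) -> exists xigam : X * R,
  [/\ gmin <= xigam.2 <= Gam, limiting_subdiff ip (neg_fun h) (x k) xigam.1,
      minimizer (subproblem ip f g grad (x k) xigam.1 xigam.2) (x k.+1) &
      accept k xigam.2 (x k.+1)].
  move=> Kk; have [gam0 [j [xi [y [/andP[g1 g2] sub rej acc_j ->]]]]] := step k.
  have [limj optj] := sub j (leqnn j).
  exists (xi j, rho ^+ j * gam0); split=> //; apply/andP; split.
    rewrite (le_trans g1)// ler_peMl ?exprn_ege1 ?ltW//.
    exact: lt_le_trans gmin_gt0 g1.
  (* The previous parameter was rejected, hence is not large. *)
  case: j sub rej {acc_j limj optj} => [|j] sub rej.
    by rewrite expr0 mul1r le_max g2.
  have [limj optj] := sub j (leqnSn j).
  rewrite le_max exprS -mulrA; apply/orP; right.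
  rewrite (ler_pM2l (lt_trans ltr01 rho_gt1)) leNgt; apply/negP => /ltW le.
  by apply: (rej j (ltnSn j)); exact: acc Kk le limj optj.
have KS k : (forall i, (i <= k)%N -> K (x i)) -> K (x k.+1).
  move=> Kx; have Kk := Kx k (leqnn k).
  have [[xi gam] /= [/andP[gam1 _] _ opt acck]] := Kstep k Kk.
  have gam0 : 0 < gam := lt_le_trans gmin_gt0 gam1.
  have gy := prox_fin_num C1_f gNy (K_O Kk) (K_fin Kk) opt.
  have [i [_ ik]] := accepted_descent Kx gy acck.
  have := mulr_ge0 (coef_ge0 gam0) (exprn_ge0 2 (normr_ge0 (x k.+1 - x k))).
  have := K_F (Kx i ik) => p1 p2 p3.
  by rewrite /= (objectiveE gy) (objectiveE gx0) lee_fin; lra.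
have Kx k : K (x k).
  elim/ltn_ind: k => -[|k] IH; first exact: lexx.
  by apply: KS => i ik; exact: IH.
have /choice[xigam xigamP] := fun k => Kstep k (Kx k).
have [B KB] := uniform_bounds.
have /andP[d0 d1] := delta01; have /andP[al0 al1] := alpha01.
pose a := (alpha * delta * gmin + (1 - alpha) * c) / 2.
have a0 : 0 < a.
  rewrite divr_gt0//; have [->|an1] := eqVneq alpha 1.
    by rewrite mul1r subrr mul0r addr0 mulr_gt0.
  rewrite ltr_wpDl ?mulr_ge0 ?(ltW d0) ?(ltW gmin_gt0)// mulr_gt0//.
  by rewrite subr_gt0 lt_neqAle an1.
exists K, Gam, a, B, (fun k => (xigam k).1), (fun k => (xigam k).2).
split=> //; first by move=> u Ku; split; [exact: K_fin|exact: K_F].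
move=> k; have [gamk lim opt acck] := xigamP k; split=> //.
  by have [_ _ _ _] := KB _ (Kx k); apply.
have [||i [mi ik]] := @accepted_descent k (xigam k).2 (x k.+1) _ _ acck.
- by move=> i _; exact: Kx.
- exact: K_fin (Kx _).
move=> le; exists i; split=> //; apply: le_trans le.
have /andP[gam1 _] := gamk.
rewrite lerD2l ler_wpM2r ?exprn_ge0// ler_pM2r// lerD2r ler_wpM2l//.
by rewrite mulr_ge0 ?(ltW d0).
Qed.

End Method.

(** * Convergence of the iterates *)

Lemma cvg_subsequence (V : topologicalType) (t : nat -> nat) (u : nat -> V)
    (v : V) : (forall n, (n <= t n)%N) -> u @ \oo --> v ->
  (fun n => u (t n)) @ \oo --> v.
Proof.
move=> tn uv; apply: cvg_comp uv => A [n _ nA].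
by exists n => // i /= ni; apply: nA => /=; exact: leq_trans (tn i).
Qed.

Section Convergence.
Context {R : realType} {X : normedModType R} (ip : {dot X for (@idfun R)}).
Variables (f g : X -> \bar R) (h : X -> R) (O : set X) (grad : X -> X)
  (x : nat -> X) (m : nat) (gmin Gam a B : R) (K : set X) (xi : nat -> X)
  (gam : nat -> R).

Local Notation fr u := (fine (f u)).
Local Notation gr u := (fine (g u)).
Local Notation F u := (fr u + gr u - h u).

Hypotheses (euclidX : is_euclidean ip)
  (open_O : open O) (domg_O : edom g `<=` O)
  (C1_f : C1_gradient ip O f grad) (lip_grad : locally_lipschitz O grad)
  (gNy : forall u, g u != -oo%E) (lsc_g : lower_semicontinuous g)
  (convex_h : convex_function (E := X) [set: X] h)
  (bnd_F : bounded_below (objective f g h))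
  (gmin_gt0 : 0 < gmin) (cK : compact K)
  (K_val : forall u, K u -> g u \is a fin_num /\ F u <= F (x 0%N))
  (Kx : forall k, K (x k)) (a0 : 0 < a)
  (steps : forall k, [/\ gmin <= gam k <= Gam,
        limiting_subdiff ip (neg_fun h) (x k) (xi k), `|xi k| <= B,
        minimizer (subproblem ip f g grad (x k) (xi k) (gam k)) (x k.+1) &
        exists i, [/\ (k - m <= i)%N, (i <= k)%N &
          F (x k.+1) + a * `|x k.+1 - x k| ^+ 2 <= F (x i)]]).

Let D k := `|x k.+1 - x k|.
Let z k : X * X := (x k.+1, xi k).
(** The merit function at z k, its conjugate term evaluated at the subgradient
    of h at x k. *)
Let T k := fr (x k.+1) + gr (x k.+1) + ip (xi k) (x k.+1 - x k) - h (x k).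

Let normE : forall u : X, `|u| = Num.sqrt (ip u u) := euclidX.1.

Let D0 k : 0 <= D k. Proof. exact: normr_ge0. Qed.

Let dom_O u : g u \is a fin_num -> O u.
Proof. by move=> gu; apply: domg_O; rewrite /edom /= ltey_eq gu. Qed.

Let K_fin u : K u -> g u \is a fin_num. Proof. by move=> /K_val[]. Qed.

Let K_O : K `<=` O. Proof. by move=> u /K_fin; exact: dom_O. Qed.

Let gam_gt0 k : 0 < gam k.
Proof. by have [/andP[+ _] _ _ _ _] := steps k; exact: lt_le_trans. Qed.

Let gam_le k : gam k <= Gam.
Proof. by have [/andP[]] := steps k. Qed.

Let sub k : subgradient ip h (x k) (- xi k).
Proof.
by have [_ lim _ _ _] := steps k; exact: (limiting_neg_subgradient euclidX convex_h).
Qed.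

Let opt k : minimizer (subproblem ip f g grad (x k) (xi k) (gam k)) (x k.+1).
Proof. by have [_ _ _ + _] := steps k. Qed.

Let meritE k : merit ip f g h (z k) = (T k)%:E.
Proof.
exact: (merit_step C1_f gNy (K_O (Kx k)) (K_fin (Kx k)) (sub k) (opt k) (K_O (Kx k.+1))).
Qed.

Let F_le_T k : F (x k.+1) <= T k.
Proof. exact: (objective_le_merit f g _ (sub k)). Qed.

Let near_descent : exists r L : R, [/\ 0 < r, 0 <= L & forall k, D k < r ->
  T k <= F (x k) + L * D k ^+ 2 /\
  `|grad (x k.+1) - grad (x k)| <= L * D k].
Proof.
have [r [L [r0 L0 desc]]] := uniform_descent normE open_O C1_f lip_grad cK K_O.
exists r, L; split=> // k Dk; have [_ lip fdesc] := desc _ _ (Kx k) Dk.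
split=> //.
have := merit_le_objective h C1_f gNy (K_O (Kx k)) (K_fin (Kx k)) (opt k) fdesc.
have : 0 <= gam k / 2 * D k ^+ 2.
  by rewrite mulr_ge0 ?exprn_ge0 ?divr_ge0 ?(ltW (gam_gt0 k)).
by rewrite -/(D k) -/(T k); lra.
Qed.

Let F_low : exists b, forall k, b <= F (x k).
Proof.
have [b bP] := bnd_F; exists b => k; have := bP (x k).
have gk := K_fin (Kx k).
by rewrite /objective (C1_fineK C1_f (dom_O gk)) -[g (x k)]fineK// lee_fin.
Qed.

(** A short step increases F at most quadratically, by the descent inequality;
    a long one also does, since F is bounded along the sequence. *)
Let F_increase : exists2 L, 0 <= L &
  forall k, F (x k.+1) <= F (x k) + L * D k ^+ 2.
Proof.
have [r [L [r0 L0 desc]]] := near_descent; have [b bP] := F_low.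
have r20 : 0 < r ^+ 2 by rewrite exprn_gt0.
pose V := F (x 0%N) - b.
have V0 : 0 <= V by rewrite subr_ge0.
exists (L + V / r ^+ 2) => [|k]; first by rewrite addr_ge0// divr_ge0// ltW.
have D2 : 0 <= D k ^+ 2 by rewrite exprn_ge0.
have LD : 0 <= L * D k ^+ 2 by rewrite mulr_ge0.
have VD : 0 <= V / r ^+ 2 * D k ^+ 2 by rewrite mulr_ge0// divr_ge0// ltW.
have [/desc[Tk _]|rD] := ltP (D k) r.
  by have := F_le_T k; lra.
have : V <= V / r ^+ 2 * D k ^+ 2.
  by rewrite mulrAC ler_pdivlMr// ler_wpM2l// ler_pXn2r ?nnegrE// ltW.
have [_ Fk] := K_val (Kx k.+1); have := bP k; rewrite /V; lra.
Qed.

Lemma descent_values : exists (l : nat -> nat) (Fs C : R),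
  [/\ [/\ 0 <= C, forall k, (k - m <= l k)%N, forall k, (l k <= k)%N &
          forall k, F (x k.+1) + a * D k ^+ 2 <= F (x (l k))],
      forall i j, (i <= j)%N -> F (x (l j)) <= F (x (l i)),
      [/\ (fun k => F (x (l k))) @ \oo --> Fs, forall k, Fs <= F (x (l k)),
          (fun k => F (x k)) @ \oo --> Fs & D @ \oo --> (0 : R)] &
      forall k, D k ^+ 2 <= C * (F (x (l k)) - F (x (l (k + m.+1)%N)))].
Proof.
have [L L0 inc] := F_increase; have [b low] := F_low.
have dec k : exists i, [/\ (k - m <= i)%N, (i <= k)%N &
    F (x k.+1) + a * D k ^+ 2 <= F (x i)].
  by have [_ _ _ _] := steps k.
pose Fx k := F (x k).
have [l lP] := window_argmax Fx m.
have [Fs MFs FsM] := window_max_cvg a0 D0 dec low lP.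
exists l, Fs, ((1 + L / a) ^+ m / a); split.
- split; [|by move=> k; have [] := lP k|by move=> k; have [] := lP k|].
    by rewrite divr_ge0 ?(ltW a0)// exprn_ge0// addr_ge0// divr_ge0// ltW.
  by move=> k; exact: (window_descent dec lP).
- by move=> i j ij; exact: (window_max_noninc a0 D0 dec lP).
- split => //; first exact: (window_values_cvg a0 L0 D0 dec inc low lP).
  have D2 := step_sqr_cvg0 a0 L0 D0 dec inc low lP.
  apply/cvgrPdist_lt => e e0; have e20 : 0 < e ^+ 2 by rewrite exprn_gt0.
  near=> k; rewrite sub0r normrN ger0_norm//.
  rewrite -(@ltr_pXn2r _ 2)// ?nnegrE// ?(ltW e0)//.
  by near: k; exact: (cvgr_lt (0 : R)).
- by move=> k; exact: (step_le_window_drop a0 L0 D0 dec inc lP).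
Unshelve. all: by end_near. Qed.

Variable (Fs : R).
Hypotheses (D_cvg : D @ \oo --> (0 : R)) (F_cvg : (fun k => F (x k)) @ \oo --> Fs).

Let T_cvg : T @ \oo --> Fs.
Proof.
have [r [L [r0 L0 desc]]] := near_descent.
apply: (@squeeze_cvgr _ _ _ _ (fun k => F (x k.+1)) (fun k => F (x k) + L * D k ^+ 2)).
- near=> k; rewrite F_le_T /=; have /desc[] // : D k < r.
  by near: k; apply: (cvgr_lt (0 : R)).
- by rewrite (cvg_shiftS (fun k => F (x k))).
- rewrite -[Fs in X in _ --> X]addr0; apply: cvgD => //.
  rewrite -[0 in X in _ --> X](mulr0 L); apply: cvgMl_tmp.
  by rewrite -[0 in X in _ --> X](mulr0 0); apply: cvgM.
Unshelve. all: by end_near. Qed.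

(** The subgradient of the merit function at z k given by the optimality of
    x k.+1. *)
Let w k : X * X :=
  (grad (x k.+1) - grad (x k) - gam k *: (x k.+1 - x k), x k.+1 - x k).

Let w_regular k : regular_subdiff (prod_ip ip) (merit ip f g h) (z k) (w k).
Proof.
exact: (merit_regular normE open_O C1_f gNy (K_O (Kx k)) (K_fin (Kx k))
  (gam_gt0 k) (sub k) (opt k) (K_O (Kx k.+1))).
Qed.

Let step_cvg0 : (fun k => x k.+1 - x k) @ \oo --> (0 : X).
Proof. by apply/norm_cvg0P. Qed.

(** Along a subsequence, comparing x k.+1 with the limit in the subproblem keeps
    the values of g from jumping down in the limit. *)
Lemma subsequence_values (t : nat -> nat) (xb xib : X) : (forall n, (n <= t n)%N) ->
  (fun n => x (t n)) @ \oo --> xb -> (fun n => xi (t n)) @ \oo --> xib ->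
  [/\ O xb, (fun n => x (t n).+1) @ \oo --> xb,
      (fun n => grad (x (t n))) @ \oo --> grad xb,
      (fun n => gr (x (t n).+1)) @ \oo --> gr xb & g xb \is a fin_num /\ F xb = Fs].
Proof.
move=> tn xt xit.
have sub_cvg V u v := @cvg_subsequence V t u v tn.
have dt := sub_cvg _ _ _ step_cvg0.
have xt1 : (fun n => x (t n).+1) @ \oo --> xb.
  rewrite (_ : (fun n => _) = fun n => (x (t n).+1 - x (t n)) + x (t n)).
    by rewrite -[xb]add0r; apply: cvgD.
  by apply/funext => n; rewrite subrK.
have Kxb : K xb.
  by apply: (closed_cvg K (compact_closed (@norm_hausdorff _ _) cK) _ _ xt); exact: nearW.
have Oxb := K_O Kxb; have gxb := K_fin Kxb.
have grad_cvg (u : nat -> X) : u @ \oo --> xb -> (fun n => grad (u n)) @ \oo --> grad xb.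
  by move=> uxb; apply: continuous_cvg => //; exact: C1_f.2.
have gradt := grad_cvg _ xt.
pose G n := grad (x (t n)) + xi (t n).
have Gt : G @ \oo --> grad xb + xib by exact: cvgD.
have xbt : (fun n => xb - x (t n)) @ \oo --> (0 : X).
  by rewrite -(subrr xb); apply: cvgB => //; exact: cvg_cst.
(* The upper bound U comes from optimality, the lower one from semicontinuity. *)
pose U n := gr xb + (ip (G n) (xb - x (t n)) +
  Gam / 2 * (`|xb - x (t n)| * `|xb - x (t n)|) - ip (G n) (x (t n).+1 - x (t n))).
have Ut : U @ \oo --> gr xb.
  rewrite -[gr xb in X in _ --> X]addr0 /U; apply: cvgD; first exact: cvg_cst.
  rewrite -[0 in X in _ --> X](subrr 0); apply: cvgB; last first.
    by rewrite -[0 in X in _ --> X](linear0r ip (grad xb + xib)); exact: (cvg_ip normE).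
  rewrite -[0 in X in _ --> X](addr0 0); apply: cvgD.
    by rewrite -[0 in X in _ --> X](linear0r ip (grad xb + xib)); exact: (cvg_ip normE).
  rewrite -[0 in X in _ --> X](mulr0 (Gam / 2)); apply: cvgMl_tmp.
  have n0 : (fun n => `|xb - x (t n)|) @ \oo --> (0 : R).
    by rewrite -(@normr0 _ X); exact: cvg_norm.
  by rewrite -[0 in X in _ --> X](mulr0 0); apply: cvgM.
have gU n : gr (x (t n).+1) <= U n.
  have := prox_ge C1_f gNy (K_O (Kx (t n))) (K_fin (Kx (t n))) (opt (t n)) xb.
  rewrite -[g xb]fineK// lee_fin /U /G => le.
  have : 0 <= gam (t n) / 2 * `|x (t n).+1 - x (t n)| ^+ 2.
    by rewrite mulr_ge0 ?exprn_ge0 ?divr_ge0 ?(ltW (gam_gt0 _)).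
  have : gam (t n) / 2 * `|xb - x (t n)| ^+ 2 <= Gam / 2 * `|xb - x (t n)| ^+ 2.
    by rewrite ler_wpM2r ?exprn_ge0// ler_pM2r.
  by move: le; rewrite -!expr2; lra.
have gt : (fun n => gr (x (t n).+1)) @ \oo --> gr xb.
  apply/cvgrPdist_lt => e e0.
  have [V xV gV] : exists2 V, nbhs xb V & forall y, V y -> ((gr xb - e)%:E < g y)%E.
    by apply: lsc_g; rewrite -[g xb]fineK// lte_fin ltrBlDr ltrDl.
  near=> n.
  have Vn : V (x (t n).+1) by near: n; exact: xt1.
  have := gV _ Vn; rewrite -[g (x _)]fineK ?lte_fin ?K_fin// => lo.
  have Un : U n < gr xb + e by near: n; apply: (cvgr_lt (gr xb)) => //; rewrite ltrDl.
  by have := gU n; rewrite ltr_norml; lra.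
split=> //; split=> //.
have frt : (fun n => fr (x (t n).+1)) @ \oo --> fr xb.
  exact: cvg_comp xt1 (C1_continuous C1_f Oxb).
have ht : (fun n => h (x (t n).+1)) @ \oo --> h xb.
  by apply: continuous_cvg => //; exact: (convex_continuous euclidX convex_h).
have Ft : (fun n => F (x (t n).+1)) @ \oo --> F xb by apply: cvgB => //; exact: cvgD.
have Ft' : (fun n => F (x (t n).+1)) @ \oo --> Fs.
  apply: (sub_cvg _ (fun k => F (x k.+1))).
  by rewrite (cvg_shiftS (fun k => F (x k))).
by rewrite -(cvg_lim (@Rhausdorff R) Ft) -(cvg_lim (@Rhausdorff R) Ft').
Unshelve. all: by end_near. Qed.

(** The points z (t n) and the subgradients w (t n), which tend to 0, witness
    that 0 is a limiting subgradient; the regular subgradients of g and the xi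
    witness stationarity. *)
Lemma cluster_point (u : X * X) : cluster (z @ \oo) u ->
  [/\ merit ip f g h u = Fs%:E,
      limiting_subdiff (prod_ip ip) (merit ip f g h) u 0,
      stationary ip g h grad u.1 &
      exists2 t : nat -> nat, (forall n, (n <= t n)%N) &
        (fun n => x (t n)) @ \oo --> u.1].
Proof.
move=> clu.
have /choice[t tP] : forall n, exists k, (n <= k)%N /\ `|z k - u| <= n.+1%:R^-1.
  move=> n; have n0 : 0 < n.+1%:R^-1 :> R by rewrite invr_gt0 ltr0n.
  have [||_ [[k nk <-]]] := clu (z @` [set k | (n <= k)%N]) (ball u n.+1%:R^-1).
  - by exists n => // k nk; exists k.
  - exact: nbhsx_ballx.
  by rewrite -ball_normE /= distrC => /ltW le; exists k.
have tn n : (n <= t n)%N by have [] := tP n.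
have zt : (fun n => z (t n)) @ \oo --> u.
  apply: (@cvg_harmonic_dist _ _ (fun=> u)) => [|n]; first exact: cvg_cst.
  by have [] := tP n.
case: u clu tP zt => xb xib _ tP zt.
have xt1 : (fun n => x (t n).+1) @ \oo --> xb.
  by apply: (@cvg_comp _ _ _ (fun n => z (t n)) fst _ _ _ zt); exact: cvg_fst.
have xit : (fun n => xi (t n)) @ \oo --> xib.
  by apply: (@cvg_comp _ _ _ (fun n => z (t n)) snd _ _ _ zt); exact: cvg_snd.
have sub_cvg V v l := @cvg_subsequence V t v l tn.
have dt := sub_cvg _ _ _ step_cvg0.
have xt : (fun n => x (t n)) @ \oo --> xb.
  rewrite (_ : (fun n => _) = fun n => x (t n).+1 - (x (t n).+1 - x (t n))).
    by rewrite -[xb]subr0; apply: cvgB.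
  by apply/funext => n; rewrite subKr.
have [Oxb _ gradt gt [gxb FxE]] := subsequence_values tn xt xit.
have gradt1 : (fun n => grad (x (t n).+1)) @ \oo --> grad xb.
  by apply: continuous_cvg => //; exact: C1_f.2.
have lim_xib : limiting_subdiff ip (neg_fun h) xb xib.
  apply: (limiting_neg_closed euclidX convex_h xt xit) => n.
  by have [] := steps (t n).
have gamt : (fun n => gam (t n) *: (x (t n).+1 - x (t n))) @ \oo --> (0 : X).
  apply/norm_cvg0P; apply: (@squeeze_cvgr _ _ _ _ (fun=> 0) (fun n => Gam * D (t n))).
  - apply: nearW => n; rewrite normr_ge0 normrZ gtr0_norm//=.
    by rewrite ler_wpM2r.
  - exact: cvg_cst.
  - by rewrite -[0 in X in _ --> X](mulr0 Gam); apply: cvgMl_tmp; exact: sub_cvg.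
have meritu : merit ip f g h (xb, xib) = Fs%:E.
  have subb := limiting_neg_subgradient euclidX convex_h lim_xib.
  rewrite /merit /= (conjugate_subgradient subb) (C1_fineK C1_f Oxb).
  rewrite -[g xb]fineK// -!EFinD -FxE; congr EFin.
  by rewrite ipNl; ring.
split => //.
- split; first by rewrite meritu.
  exists (fun n => z (t n)), (fun n => w (t n)); split => //.
  + rewrite meritu (_ : _ \o _ = fun n => (T (t n))%:E).
      by apply: cvg_EFin; [exact: nearW|exact: sub_cvg].
    by apply/funext => n /=; rewrite meritE.
  + apply: cvg_pair => //=.
    rewrite -[0 in X in _ --> X](subr0 0); apply: cvgB => //.
    by rewrite -(subrr (grad xb)); exact: cvgB.
- exists (- (grad xb + xib)), xib; split => //; last first.
    by rewrite opprD addrA subrr add0r addNr.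
  split => //; exists (fun n => x (t n).+1),
    (fun n => - (grad (x (t n)) + xi (t n)) - gam (t n) *: (x (t n).+1 - x (t n))).
  split => //.
  + rewrite -[g xb]fineK// (_ : _ \o _ = fun n => (gr (x (t n).+1))%:E).
      by apply: cvg_EFin; [exact: nearW|].
    by apply/funext => n /=; rewrite fineK// K_fin.
  + rewrite -[- _ in X in _ --> X]subr0; apply: cvgB => //; apply: cvgN.
    exact: cvgD.
  + move=> n; exact: (prox_regular normE C1_f gNy (K_O (Kx _)) (K_fin (Kx _))).
- by exists t.
Qed.

Let KB := K `*` [set v : X | `|v| <= B].

Let KB_compact : compact KB.
Proof.
apply: compact_setX => //; apply: (bounded_closed_compact_euclid normE euclidX).
  exists B; split; first exact: num_real.
  by move=> t Bt u /le_trans; apply; exact: ltW.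
rewrite (_ : mkset _ = (fun u : X => `|u|) @^-1` [set t | t <= B])//.
by apply: closed_comp => [u _|]; [exact: norm_continuous|exact: closed_le].
Qed.

Let z_KB k : KB (z k).
Proof. by have [_ _ xiB _ _] := steps k; split; [exact: Kx|exact: xiB]. Qed.

Lemma cluster_exists : exists u, cluster (z @ \oo) u.
Proof.
have [|u [_ clu]] := KB_compact (F := z @ \oo); last by exists u.
by exists 0%N => // k _; exact: z_KB.
Qed.

(** At the index k + m + 1 the window maximum is a value F (x q.+1) with q >= k,
    below T q because the merit function dominates F.  So the inequality at z q
    may be read at the smaller argument r (k + m + 1), psi being antitone, and
    the step D q is controlled by the decrease of r. *)
Lemma KL_along (Q : (R -> R) -> Prop) (l : nat -> nat) :
  (forall phi1 phi2, Q phi1 -> Q phi2 -> Q (fun t => phi1 t + phi2 t)) ->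
  (forall u, dom_subdiff (prod_ip ip) (merit ip f g h) u ->
     exists (eta : \bar R) U phi, [/\ (0 < eta)%E, nbhs u U,
       desingularizing eta phi, Q phi &
       KL_inequality (prod_ip ip) (merit ip f g h) u eta U phi]) ->
  (forall k, (k - m <= l k)%N) ->
  (forall k, F (x k.+1) + a * D k ^+ 2 <= F (x (l k))) ->
  (forall i j, (i <= j)%N -> F (x (l j)) <= F (x (l i))) ->
  (fun k => F (x (l k))) @ \oo --> Fs ->
  exists eta b phi psi K1, [/\ gauge eta phi psi, Q phi, 0 <= b,
    F (x (l K1)) - Fs < eta /\ F (x (l K1)) - Fs <= 1 &
    forall k, (K1 <= k)%N -> 0 < F (x (l (k + m.+1)%N)) - Fs ->
      1 <= psi (F (x (l (k + m.+1)%N)) - Fs) * (b * Num.sqrt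
        (F (x (l k)) - Fs - (F (x (l (k + m.+1)%N)) - Fs)))].
Proof.
move=> QD KL ml dec noninc Mcvg.
have [eta [phi [psi [eta0 gau Qphi near_KL]]]] :=
  @uniform_KL _ _ (prod_ip ip) (merit ip f g h) Q KB z Fs QD KB_compact z_KB
    (fun u clu => let: And4 mu du _ _ := cluster_point clu in
      conj mu (KL u (ex_intro _ 0 du))).
have [r [L [r0 L0 desc]]] := near_descent.
have Gam0 : 0 < Gam := lt_le_trans (gam_gt0 0%N) (gam_le 0%N).
pose b := (L + Gam + 1) / Num.sqrt a.
have sa0 : 0 < Num.sqrt a by rewrite sqrtr_gt0.
have LG : 0 <= L + Gam + 1 by lra.
have b0 : 0 <= b by rewrite divr_ge0// ltW.
have [K1 _ K1P] : \forall n \near \oo, [/\ forall v,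
    limiting_subdiff (prod_ip ip) (merit ip f g h) (z n) v ->
      Fs < T n < Fs + eta -> 1 <= psi (T n - Fs) * ipnorm (prod_ip ip) v,
    D n < r, T n < Fs + eta & F (x (l n)) < Fs + Num.min eta 1].
  near=> n; split.
  - by have := near near_KL n _; rewrite meritE; apply.
  - by near: n; exact: (cvgr_lt (0 : R)).
  - by near: n; apply: (cvgr_lt Fs) => //; rewrite ltrDl.
  - by near: n; apply: (cvgr_lt Fs) => //; rewrite ltrDl lt_min eta0 ltr01.
exists eta, b, phi, psi, K1; split => //.
  have [_ _ _] := K1P K1 (leqnn _); rewrite -ltrBlDl lt_min => /andP[-> /ltW ->//].
move=> k K1k; set rN := F _ - Fs => rN0.
have mlk := ml (k + m.+1)%N.
have [q lq] : exists q, l (k + m.+1)%N = q.+1.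
  by exists (l (k + m.+1)%N).-1; rewrite prednK// (leq_trans _ mlk)// addnS subSn// leq_addl.
have kq : (k <= q)%N.
  by rewrite -ltnS -lq (leq_trans _ mlk)// addnS subSn ?addnK// leq_addl.
have [KLq Dq Tq _] := K1P q (leq_trans K1k kq).
have TrN : rN <= T q - Fs by rewrite /rN lq lerB// F_le_T.
have [_ lip] := desc q Dq.
have kl := KLq (w q) (regular_limiting_subdiff (w_regular q)).
have {}kl : 1 <= psi (T q - Fs) * ipnorm (prod_ip ip) (w q).
  by apply: kl; rewrite Tq andbT -subr_gt0 (lt_le_trans rN0).
have psi_le : psi (T q - Fs) <= psi rN.
  by apply: (gauge_antitone gau) => //; rewrite ltrBlDl.
have [_ psi0 _] := gau.
have psi_rN : 0 <= psi rN.
  by apply/ltW/psi0; rewrite rN0 (le_lt_trans TrN)// ltrBlDl.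
have wD : ipnorm (prod_ip ip) (w q) <= (L + Gam + 1) * D q.
  apply: (le_trans (merit_subgradient_le normE (gam_gt0 q) lip)).
  by rewrite ler_wpM2r// lerD2r lerD2l.
have Ddrop : Num.sqrt a * D q <= Num.sqrt (F (x (l k)) - Fs - rN).
  rewrite -[D q]ger0_norm// -sqrtr_sqr -sqrtrM ?(ltW a0)// ler_wsqrtr//.
  by have := dec q; have := noninc _ _ kq; rewrite /rN lq; lra.
apply: (le_trans kl); apply: (@le_trans _ _ (psi rN * ((L + Gam + 1) * D q))).
  by apply: ler_pM => //; [apply/ltW/psi0; rewrite (lt_le_trans rN0)//= ltrBlDl
    |exact: sqrtr_ge0].
rewrite ler_wpM2l// /b -mulrA ler_wpM2l//.
by rewrite [_^-1 * _]mulrC ler_pdivlMr// mulrC.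
Unshelve. all: by end_near. Qed.

End Convergence.

Theorem theorem9 (R : realType) (X : normedModType R)
    (ip : {dot X for (@idfun R)}) (euclidX : is_euclidean ip)
    (f g : X -> \bar R) (h : X -> R)
    (O : set X) (grad : X -> X)
    (m : nat) (gmin gmax rho delta alpha c : R) (x : nat -> X)
    (proper_f : proper_efun f) (lsc_f : lower_semicontinuous f)
    (open_O : open O) (domg_O : edom g `<=` O)
    (C1_f : C1_gradient ip O f grad) (lip_grad : locally_lipschitz O grad)
    (proper_g : proper_efun g) (lsc_g : lower_semicontinuous g)
    (bnd_g : bounded_below g)
    (convex_h : convex_function (E := X) [set: X] h)
    (bnd_F : bounded_below (objective f g h))
    (gmin_gt0 : 0 < gmin) (gmin_gmax : gmin <= gmax) (rho_gt1 : 1 < rho)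
    (delta01 : 0 < delta < 1) (alpha01 : 0 <= alpha <= 1) (c_gt0 : 0 < c)
    (NPG_x : NPG_sequence ip f g h grad m gmin gmax rho delta alpha c x)
    (KL_Theta : KL_function (prod_ip ip) (merit ip f g h))
    (bnd_L : bounded_set
       [set y : X | (objective f g h y <= objective f g h (x 0%N))%E]) :
  exists xbar : X,
    [/\ x @ \oo --> xbar,
        stationary ip g h grad xbar &
        forall theta : R, 0 < theta < 1 ->
          KL_function_exponent (prod_ip ip) theta (merit ip f g h) ->
          exists C q : R,
            [/\ 0 < C, 0 < q < 1 &
              \forall k \near \oo,
                (`|x k - xbar|%:E <=
                   \sum_(k <= j <oo) `|x j.+1 - x j|%:E)%E /\
                (\sum_(k <= j <oo) `|x j.+1 - x j|%:E <=
                   (if theta <= 2^-1 then C * q ^+ k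
                    else C * k%:R `^ ((1 - theta) / (1 - 2 * theta)))%:E)%E]].
Proof.
have gNy := proper_g.2.
have [K [Gam [a [B [xi [gam [cK K_val Kx a0 steps]]]]]]] := NPG_iterates euclidX
  proper_f lsc_f open_O domg_O C1_f lip_grad proper_g lsc_g bnd_g convex_h
  gmin_gt0 rho_gt1 delta01 alpha01 c_gt0 NPG_x bnd_L.
have [l [Fs [C [[C0 ml lk dec] noninc [Mcvg FsM Fcvg Dcvg] Dle]]]] :=
  descent_values euclidX open_O domg_O C1_f lip_grad gNy convex_h bnd_F gmin_gt0
    cK K_val Kx a0 steps.
have clP := cluster_point euclidX open_O domg_O C1_f lip_grad gNy lsc_g convex_h
  gmin_gt0 cK K_val Kx steps Dcvg Fcvg.
have KLP := KL_along euclidX open_O domg_O C1_f lip_grad gNy lsc_g convex_h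
  gmin_gt0 cK K_val Kx a0 steps Dcvg Fcvg.
have [u clu] := cluster_exists euclidX cK Kx steps.
have [_ _ statu [t tn xt]] := clP u clu.
pose D k := `|x k.+1 - x k|.
pose r k := fine (f (x (l k))) + fine (g (x (l k))) - h (x (l k)) - Fs.
have r0 k : 0 <= r k by rewrite subr_ge0.
have rnoninc i j : (i <= j)%N -> r j <= r i.
  by move=> ij; rewrite lerB// noninc.
have Dr k : D k <= Num.sqrt C * Num.sqrt (r k - r (k + m.+1)%N).
  rewrite -[D k]ger0_norm ?normr_ge0// -sqrtr_sqr -sqrtrM// ler_wsqrtr//.
  by rewrite (le_trans (Dle k))// ler_wpM2l// /r; lra.
pose A := Num.sqrt C * m.+1%:R.
have A0 : 0 <= A by rewrite mulr_ge0 ?sqrtr_ge0.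
have tail_le eta b phi psi K1 : gauge eta phi psi -> 0 <= b -> r K1 < eta ->
    (forall k, (K1 <= k)%N -> 0 < r (k + m.+1)%N ->
      1 <= psi (r (k + m.+1)%N) * (b * Num.sqrt (r k - r (k + m.+1)%N))) ->
    forall j, (K1 <= j)%N -> (\sum_(j <= k <oo) (D k)%:E <=
      (A * (2 * Num.sqrt (r j) + b * phi (r j)))%:E)%E.
  move=> gau b0 rK kl j K1j; apply: nneseries_le_bound => [k|n]; first exact: normr_ge0.
  have := KL_tail_le gau r0 rnoninc b0 rK kl n K1j.
  move=> /(ler_wpM2l (sqrtr_ge0 C)); rewrite mulrA -/A; apply: le_trans.
  by rewrite mulr_sumr; apply: ler_sum => k _; exact: Dr.
have dist_tail k := dist_le_tail k tn xt.
exists u.1; split => //.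
- have [|eta [b [phi [psi [K1 [gau _ b0 [rK _] kl]]]]]] :=
    KLP (fun=> True) l (fun _ _ _ _ => I) _ ml dec noninc Mcvg.
    by move=> v /KL_Theta[eta [U [phi [? ? ? ?]]]]; exists eta, U, phi.
  have tK1 := tail_le _ _ _ _ _ gau b0 rK kl K1 (leqnn _).
  have D0 k : (0 <= (D k)%:E)%E by rewrite lee_fin normr_ge0.
  (* The steps have a finite sum, whose tails bound the distance to the limit. *)
  have tot : (\sum_(0 <= k <oo) (D k)%:E < +oo)%E.
    rewrite (nneseries_split 0 K1); last by move=> k _; exact: D0.
    rewrite add0n sumEFin; apply: (@le_lt_trans _ _ _ _ _ (leeD2l _ tK1)).
    by rewrite -EFinD ltry.
  have tail0 := nneseries_tail_cvg tot (fun k _ => D0 k).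
  have : (fun k => `|x k - u.1|%:E) @ \oo --> 0%E.
    apply: (@squeeze_cvge _ _ _ _ (fun=> 0%E) _ (fun k => \sum_(k <= j <oo) (D j)%:E)%E).
    + by apply: nearW => k; rewrite lee_fin normr_ge0 /=; exact: dist_tail.
    + exact: cvg_cst.
    + exact: tail0.
  move=> /fine_cvgP[_ /= nx].
  rewrite -(subr_cvg0) ; exact/norm_cvg0P.
- move=> theta th KLth.
  pose Q phi := exists2 c0 : R, 0 < c0 & forall t, phi t = c0 * t `^ (1 - theta).
  have QD (phi1 phi2 : R -> R) : Q phi1 -> Q phi2 -> Q (fun t => phi1 t + phi2 t).
    move=> [c1 c10 e1] [c2 c20 e2]; exists (c1 + c2); first exact: addr_gt0.
    by move=> s; rewrite e1 e2 mulrDl.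
  have [|eta [b [phi [psi [K1 [gau [c0 c00 phiE] b0 [rK rK1] kl]]]]]] :=
    KLP Q l QD _ ml dec noninc Mcvg.
    move=> v /KLth[eta [U [c0 [? ? ? ? ?]]]].
    by exists eta, U, (fun t => c0 * t `^ (1 - theta)); split => //; exists c0.
  have [C' [q [C'0 q01 [K2 rate]]]] := KL_tail_rate (ltn0Sn m) r0 rnoninc rK1 rK
    A0 b0 c00 th gau phiE kl.
  exists C', q; split=> //; exists (maxn K1 K2) => // k /=.
  rewrite geq_max => /andP[K1k K2k]; split; first exact: dist_tail.
  apply: (le_trans (tail_le _ _ _ _ _ gau b0 rK kl k K1k)).
  by rewrite lee_fin rate.
Qed.
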